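(* Let $\Lambda$ be the lattice of all lattice varieties (ordered by inclusion), with covering relation $\prec$. With the varieties defined in the context, the following hold. (i) $\mathcal M\prec\mathcal N_5^{m}$ and $\mathcal N_5^{m}$ is the only cover of $\mathcal M$ in $\Lambda$. Furthermore, for every $\mathcal Y\in\Lambda$, $\mathcal Y\not\le\mathcal M$ implies that $\mathcal N_5\le\mathcal Y$. (ii) For $i\in\{1,\dots,15\}$, $\mathcal N_5^{m}\prec\mathcal L_i^{m}$. (iii) For $j\in\{1,\dots,8\}$, $\mathcal N_5^{m}\prec\mathcal V_j^{m}$. (iv) The set $\{\mathcal L_i^{m}:1\le i\le 15\}\cup\{\mathcal V_j^{m}:1\le j\le 8\}$ is a $23$-element subset of $\Lambda$ and it generates a sublattice isomorphic to the $2^{23}$-element Boolean lattice, and this sublattice is an interval in $\Lambda$.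
   Context: $\mathcal M$ is the variety of modular lattices, $\mathbf{HSP}X$ is the variety generated by $X$, and for a lattice variety $\mathcal Z$ we put $\mathcal Z^{m}:=\mathcal Z\vee\mathcal M$ (join in $\Lambda$). $N_5$ is the five-element nonmodular lattice, $\mathcal N_5=\mathbf{HSP}\{N_5\}$, $\mathcal L_i=\mathbf{HSP}\{L_i\}$ ($1\le i\le 15$), $\mathcal V_j=\mathbf{HSP}\{V_j\}$ ($1\le j\le 8$), where $L_i$, $V_j$ are the finite subdirectly irreducible lattices below (each given by its covering relation, also denoted $\prec$; ''$x\prec y,z$'' abbreviates $x\prec y$ and $x\prec z$, and ''$x,y\prec z$'' abbreviates $x\prec z$ and $y\prec z$). *The lattices $L_i$* (McKenzie's list): - $L_1=\{0,a,b,c,p,q,1\}$: $0\prec a,b,c$; $a,b\prec p$; $b,c\prec q$; $p,q\prec1$. - $L_2$ is the dual of $L_1$. - $L_3=\{0,e,a,p,b,c,1\}$: $0\prec e\prec a\prec p\prec 1$; $e\prec c\prec 1$; $0\prec b\prec p$. - $L_4=\{0,a,b,c,d,1\}$: $0\prec a,b,c$; $a,b\prec d\prec1$; $c\prec 1$. - $L_5$ is the dual of $L_4$. - By a theorem of Jónsson and Rival, $\mathcal N_5$ has exactly fifteen covers in $\Lambda$ that are join-irreducible in $\Lambda$; each is generated by a finite subdirectly irreducible lattice, unique up to isomorphism. Five of them are $\mathcal L_1,\dots,\mathcal L_5$; $L_6,\dots,L_{15}$ are the finite subdirectly irreducible lattices generating the other ten (their order is irrelevant here). *The lattices $V_j$*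 (Ruckelshausen's list): - $V_6=\{0,r,w,u,x,y,z,v,1\}$: $0\prec r,u$; $r\prec w,x$; $w\prec 1$; $u\prec x,y,z$; $x,y,z\prec v\prec 1$. - $V_7$ is the dual of $V_6$. - $V_1,\dots,V_5,V_8$ are the following six lattices (their order is irrelevant here): (1) $\{0,a,a',b,c,1\}$ with $0\prec a\prec a'\prec 1$, $0\prec b\prec 1$, $0\prec c\prec1$; (2) $\{0,w,u,x,y,z,v,1\}$ with $0\prec w\prec1$, $0\prec u\prec x,y,z$ and $x,y,z\prec v\prec 1$; (3) $\{u,o,d,e,c,a,b,i\}$ with $u\prec o,d,e$; $o,d,e\prec c\prec i$; $o\prec a\prec b\prec i$; (4) the dual of (3); (5) $\{u,o,d,e,a,b,c,i\}$ with $u\prec o,d,e$; $o,d,e\prec a\prec b\prec i$; $o\prec c\prec i$; (6) the dual of (5). *)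

(* Defs.v *)
From HB Require Import structures.
From mathcomp Require Import all_boot all_order.

Set Implicit Arguments.
Unset Strict Implicit.
Unset Printing Implicit Defensive.

Import Order.Theory.
Local Open Scope order_scope.

(* The display is only a notational tag, so fixing one loses no generality.
   The carrier of a [latticeType] may be empty. This does not affect the
   lattice of varieties: every class closed under H, S and P contains the
   one-element lattice (empty product), hence the empty one, and V |-> V minus
   the empty lattice is an order isomorphism onto the varieties of nonempty
   lattices. *)
Notation lattice := (latticeType (Order.Disp tt tt)).

Definition lclass := lattice -> Prop.

Definition H_closure (X : lclass) : lclass := fun Q =>
  exists (A : lattice) (f : {lmorphism A -> Q}),
    X A /\ (forall q : Q, exists a : A, f a = q).

Definition S_closure (X : lclass) : lclass := fun B =>
  exists (A : lattice) (f : {lmorphism B -> A}), X A /\ injective f.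

(* B is the direct product of the A i: it has projections onto the A i, and
   every choice of coordinates is realised by exactly one element. *)
Definition P_closure (X : lclass) : lclass := fun B =>
  exists (I : Type) (A : I -> lattice) (p : forall i, {lmorphism B -> A i}),
    (forall i, X (A i)) /\
    (forall x : (forall i, A i), exists! b : B, forall i, p i b = x i).

Definition closed_under (op : lclass -> lclass) (X : lclass) : Prop :=
  forall A : lattice, op X A -> X A.

Definition is_variety (X : lclass) : Prop :=
  [/\ closed_under H_closure X, closed_under S_closure X
    & closed_under P_closure X].

Record variety := Variety {
  vclass :> lattice -> Prop;
  varietyP : is_variety vclass
}.

Definition var_le (V W : variety) : Prop := forall A : lattice, V A -> W A.
Definition var_lt (V W : variety) : Prop := var_le V W /\ V <> W.
Definition var_covers (V W : variety) : Prop :=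
  var_lt V W /\ ~ (exists Z : variety, var_lt V Z /\ var_lt Z W).

Lemma is_variety_bigcap (F : lclass -> Prop) :
  (forall V, F V -> is_variety V) ->
  is_variety (fun A => forall V, F V -> V A).
Proof.
move=> FV; split=> A.
- move=> [B [f [XB fs]]] V VF; have [h _ _] := FV _ VF.
  by apply: h; exists B, f; split=> //; apply: XB.
- move=> [B [f [XB fi]]] V VF; have [_ h _] := FV _ VF.
  by apply: h; exists B, f; split=> //; apply: XB.
- move=> [I [B [p [XB pb]]]] V VF; have [_ _ h] := FV _ VF.
  by apply: h; exists I, B, p; split=> // i; apply: XB.
Qed.

Definition HSP_class (X : lclass) : lclass := fun A =>
  forall V : lclass, (is_variety V /\ forall B, X B -> V B) -> V A.

Lemma HSP_is_variety (X : lclass) : is_variety (HSP_class X).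
Proof. by apply: is_variety_bigcap => V []. Qed.

(* The variety generated by X, i.e. the least one containing X. *)
Definition HSP (X : lclass) : variety := Variety (HSP_is_variety X).

Definition HSP1 (L : lattice) : variety := HSP (fun A => A = L).

(* Binary operations of the lattice of varieties, ordered by [var_le]. *)
Definition var_join (V W : variety) : variety := HSP (fun A => V A \/ W A).

Lemma var_meet_is_variety (V W : variety) : is_variety (fun A => V A /\ W A).
Proof.
case: V W => [V [HV SV PV]] [W [HW SW PW]]; split=> A /=.
- by move=> [B [f [[? ?] ?]]]; split; [apply: HV|apply: HW]; exists B, f.
- by move=> [B [f [[? ?] ?]]]; split; [apply: SV|apply: SW]; exists B, f.
- move=> [I [B [p [XB ?]]]]; split; [apply: PV|apply: PW]; exists I, B, p;
  by split=> // i; have [] := XB i.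
Qed.

Definition var_meet (V W : variety) : variety :=
  Variety (var_meet_is_variety V W).

Definition var_join_irreducible (V : variety) : Prop :=
  forall A B : variety, V = var_join A B -> V = A \/ V = B.

Definition has_n_elements (n : nat) (S : variety -> Prop) : Prop :=
  exists g : 'I_n -> variety,
    injective g /\ forall Y, S Y <-> exists k, g k = Y.

Definition is_sublattice (S : variety -> Prop) : Prop :=
  forall V W, S V -> S W -> S (var_join V W) /\ S (var_meet V W).

Definition generated_sublattice (G : variety -> Prop) : variety -> Prop :=
  fun Y => forall S : variety -> Prop,
    is_sublattice S -> (forall V, G V -> S V) -> S Y.

(* The 2^n-element Boolean lattice is realised as the subsets of 'I_n. *)
Definition isomorphic_to_Boolean (n : nat) (S : variety -> Prop) : Prop :=
  exists f : {set 'I_n} -> variety,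
    [/\ injective f,
        forall Y, S Y <-> exists A, f A = Y,
        forall A B, f (A :|: B) = var_join (f A) (f B)
      & forall A B, f (A :&: B) = var_meet (f A) (f B)].

Definition is_interval (S : variety -> Prop) : Prop :=
  exists V W : variety,
    var_le V W /\ forall Y, S Y <-> var_le V Y /\ var_le Y W.

Definition modular (A : lattice) : Prop :=
  forall x y z : A, x <= z -> x `|` (y `&` z) = (x `|` y) `&` z.

Lemma modular_is_variety : is_variety modular.
Proof.
have mI (A B : lattice) (f : {lmorphism A -> B}) x y :
  f (x `&` y) = f x `&` f y by apply: omorphI.
have mU (A B : lattice) (f : {lmorphism A -> B}) x y :
  f (x `|` y) = f x `|` f y by apply: omorphU.
split=> A.
- move=> [B [f [mB fs]]] x y z xz.
  have [a fa] := fs x; have [b fb] := fs y; have [c fc] := fs z.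
  rewrite -(join_r xz) -fa -fb -fc -!mU -!mI -!mU.
  by rewrite (mB _ _ _ (leUl a c)).
- move=> [B [f [mB fi]]] x y z xz; apply: fi.
  by rewrite !(mU, mI); apply: mB; rewrite leEmeet -mI (meet_l xz).
- move=> [I [B [p [mB pb]]]] x y z xz.
  have [b [_ ub]] := pb (fun i => p i (x `|` (y `&` z))).
  rewrite -(ub (x `|` (y `&` z))) //; apply: ub => i.
  by rewrite !(mU, mI) mB // leEmeet -mI (meet_l xz).
Qed.

Definition M_var : variety := Variety modular_is_variety.

Definition with_M (Z : variety) : variety := var_join Z M_var.

Definition finite_lattice (A : lattice) : Prop :=
  exists s : seq A, forall x : A, x \in s.

(* Every subdirect representation (a family of surjections that jointly
   separates points) has an isomorphism among its components. *)
Definition subdirectly_irreducible (A : lattice) : Prop :=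
  forall (I : Type) (B : I -> lattice) (f : forall i, {lmorphism A -> B i}),
    (forall i (b : B i), exists a : A, f i a = b) ->
    (forall x y : A, (forall i, f i x = f i y) -> x = y) ->
    exists i, injective (f i).

(* [up_path cov k x y]: y is reached from x in at most k steps along cov. *)
Fixpoint up_path (cov : seq (nat * nat)) (k x y : nat) : bool :=
  (x == y) ||
  (if k is k'.+1 then has (fun e => (e.1 == x) && up_path cov k' e.2 y) cov
   else false).

Section Diagram.
Variables (n : nat) (cov : seq (nat * nat)).
Local Notation elts := (iota 0 n).
Local Notation le := (up_path cov n).

Definition is_glb x y z := all (fun w => le w z == le w x && le w y) elts.
Definition is_lub x y z := all (fun w => le z w == le x w && le y w) elts.

(* cov is the covering relation of a lattice order on {0, ..., n-1} *)
Definition is_lattice_diagram : bool :=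
  [&& all (fun e => (e.1 < n)%N && (e.2 < n)%N) cov,
      all (fun e => (e.1 != e.2) &&
        all (fun w => le e.1 w && le w e.2 ==> (w == e.1) || (w == e.2)) elts)
        cov,
      all (fun x => all (fun y => le x y && le y x ==> (x == y)) elts) elts,
      all (fun y => all (fun x => all (fun z =>
        le x y && le y z ==> le x z) elts) elts) elts,
      all (fun x => all (fun y => has (is_glb x y) elts) elts) elts
    & all (fun x => all (fun y => has (is_lub x y) elts) elts) elts].
End Diagram.

Record diagram := Diagram {
  dsize : nat;
  dcov : seq (nat * nat);
  diagramP : is_lattice_diagram dsize dcov
}.

Definition delt (D : diagram) : Type := 'I_(dsize D).

HB.instance Definition _ (D : diagram) := Choice.copy (delt D) 'I_(dsize D).

Section DiagramLattice.
Variable D : diagram.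
Local Notation n := (dsize D).
Local Notation E := (dcov D).

Definition dle (x y : delt D) : bool :=
  up_path E n (nat_of_ord x) (nat_of_ord y).

Let in_iota (x : delt D) : nat_of_ord x \in iota 0 n.
Proof. by rewrite mem_iota add0n ltn_ord. Qed.

Let wf := diagramP D.

Lemma dle_refl : reflexive dle.
Proof. by move=> x; rewrite /dle; case: {1}(dsize D) => *; rewrite /= eqxx. Qed.

Lemma dle_anti : antisymmetric dle.
Proof.
move=> x y xy; apply: val_inj.
have /and5P[_ _ /allP /(_ _ (in_iota x)) /allP /(_ _ (in_iota y)) h _ _] := wf.
by apply/eqP; move: h; rewrite xy.
Qed.

Lemma dle_trans : transitive dle.
Proof.
move=> y x z xy yz.
have /and5P[_ _ _ /allP /(_ _ (in_iota y)) /allP /(_ _ (in_iota x)) h _] := wf.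
by move/allP: h => /(_ _ (in_iota z)); rewrite -!/(dle _ _) xy yz.
Qed.

Lemma dmeet_subproof (x y : delt D) : (find (is_glb n E x y) (iota 0 n) < n)%N.
Proof.
have /and5P[_ _ _ _ /andP[/allP /(_ _ (in_iota x)) h _]] := wf.
by move/allP: h => /(_ _ (in_iota y)); rewrite has_find size_iota.
Qed.

Lemma djoin_subproof (x y : delt D) : (find (is_lub n E x y) (iota 0 n) < n)%N.
Proof.
have /and5P[_ _ _ _ /andP[_ /allP /(_ _ (in_iota x)) h]] := wf.
by move/allP: h => /(_ _ (in_iota y)); rewrite has_find size_iota.
Qed.

Definition dmeet (x y : delt D) : delt D := Ordinal (dmeet_subproof x y).
Definition djoin (x y : delt D) : delt D := Ordinal (djoin_subproof x y).

Lemma dle_meet x y z : dle x (dmeet y z) = dle x y && dle x z.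
Proof.
have fn := dmeet_subproof y z.
have hs : has (is_glb n E y z) (iota 0 n) by rewrite has_find size_iota.
have := nth_find 0 hs; rewrite nth_iota // add0n => /allP /(_ _ (in_iota x)).
by move/eqP.
Qed.

Lemma djoin_le x y z : dle (djoin x y) z = dle x z && dle y z.
Proof.
have fn := djoin_subproof x y.
have hs : has (is_lub n E x y) (iota 0 n) by rewrite has_find size_iota.
have := nth_find 0 hs; rewrite nth_iota // add0n => /allP /(_ _ (in_iota z)).
by move/eqP.
Qed.
End DiagramLattice.

HB.instance Definition _ (D : diagram) :=
  Order.Le_isPOrder.Build (Order.Disp tt tt) (delt D)
    (@dle_refl D) (@dle_anti D) (@dle_trans D).
HB.instance Definition _ (D : diagram) :=
  Order.POrder_MeetJoin_isLattice.Build (Order.Disp tt tt) (delt D)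
    (@dle_meet D) (@djoin_le D).

Definition lattice_of (D : diagram) : lattice := delt D.
Coercion lattice_of : diagram >-> Order.Lattice.type.

Definition flip (cov : seq (nat * nat)) : seq (nat * nat) :=
  [seq (e.2, e.1) | e <- cov].

(* In the diagrams below [o] is the least and [i] the greatest element, except
   in [W3] to [W6], which keep [o] as the name of an inner element. *)
Local Open Scope nat_scope.

Definition N5_cov :=
  let: (o, a, b, c, i) := (0, 1, 2, 3, 4) in
  [:: (o, a); (a, b); (b, i); (o, c); (c, i)].
Definition N5 := @Diagram 5 N5_cov erefl.

Definition L1_cov :=
  let: (o, a, b, c, p, q, i) := (0, 1, 2, 3, 4, 5, 6) in
  [:: (o, a); (o, b); (o, c); (a, p); (b, p); (b, q); (c, q); (p, i); (q, i)].
Definition L1 := @Diagram 7 L1_cov erefl.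
Definition L2 := @Diagram 7 (flip L1_cov) erefl.

Definition L3_cov :=
  let: (o, e, a, p, b, c, i) := (0, 1, 2, 3, 4, 5, 6) in
  [:: (o, e); (e, a); (a, p); (p, i); (e, c); (c, i); (o, b); (b, p)].
Definition L3 := @Diagram 7 L3_cov erefl.

Definition L4_cov :=
  let: (o, a, b, c, d, i) := (0, 1, 2, 3, 4, 5) in
  [:: (o, a); (o, b); (o, c); (a, d); (b, d); (d, i); (c, i)].
Definition L4 := @Diagram 6 L4_cov erefl.
Definition L5 := @Diagram 6 (flip L4_cov) erefl.

Definition V6_cov :=
  let: (o, r, w, u, x, y, z, v, i) := (0, 1, 2, 3, 4, 5, 6, 7, 8) in
  [:: (o, r); (o, u); (r, w); (r, x); (w, i); (u, x); (u, y); (u, z);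
      (x, v); (y, v); (z, v); (v, i)].
Definition V6 := @Diagram 9 V6_cov erefl.
Definition V7 := @Diagram 9 (flip V6_cov) erefl.

Definition W1_cov :=
  let: (o, a, a', b, c, i) := (0, 1, 2, 3, 4, 5) in
  [:: (o, a); (a, a'); (a', i); (o, b); (b, i); (o, c); (c, i)].
Definition W1 := @Diagram 6 W1_cov erefl.

Definition W2_cov :=
  let: (o, w, u, x, y, z, v, i) := (0, 1, 2, 3, 4, 5, 6, 7) in
  [:: (o, w); (w, i); (o, u); (u, x); (u, y); (u, z);
      (x, v); (y, v); (z, v); (v, i)].
Definition W2 := @Diagram 8 W2_cov erefl.

Definition W3_cov :=
  let: (u, o, d, e, c, a, b, i) := (0, 1, 2, 3, 4, 5, 6, 7) in
  [:: (u, o); (u, d); (u, e); (o, c); (d, c); (e, c); (c, i);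
      (o, a); (a, b); (b, i)].
Definition W3 := @Diagram 8 W3_cov erefl.
Definition W4 := @Diagram 8 (flip W3_cov) erefl.

Definition W5_cov :=
  let: (u, o, d, e, a, b, c, i) := (0, 1, 2, 3, 4, 5, 6, 7) in
  [:: (u, o); (u, d); (u, e); (o, a); (d, a); (e, a); (a, b); (b, i);
      (o, c); (c, i)].
Definition W5 := @Diagram 8 W5_cov erefl.
Definition W6 := @Diagram 8 (flip W5_cov) erefl.

Definition N5_var : variety := HSP1 N5.

Definition L1_to_5 (i : 'I_5) : lattice :=
  match nat_of_ord i with
  | 0 => L1 | 1 => L2 | 2 => L3 | 3 => L4 | _ => L5
  end.

(* K lists L_6, ..., L_15: finite subdirectly irreducible lattices generating,
   without repetition, exactly the join-irreducible covers of N5_var other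
   than those generated by L_1, ..., L_5. *)
Definition lists_L6_to_15 (K : 'I_10 -> lattice) : Prop :=
  [/\ forall k, finite_lattice (K k) /\ subdirectly_irreducible (K k),
      injective (fun k => HSP1 (K k))
    & forall Y : variety,
        (exists k, Y = HSP1 (K k)) <->
        [/\ var_covers N5_var Y, var_join_irreducible Y
          & forall i, Y <> HSP1 (L1_to_5 i)]].

(* The families below are indexed from 0. *)
Definition L_var (K : 'I_10 -> lattice) (i : 'I_15) : variety :=
  match split (i : 'I_(5 + 10)) with
  | inl j => HSP1 (L1_to_5 j)
  | inr k => HSP1 (K k)
  end.

Definition V_lattice (j : 'I_8) : lattice :=
  match nat_of_ord j with
  | 0 => W1 | 1 => W2 | 2 => W3 | 3 => W4 | 4 => W5 | 5 => V6 | 6 => V7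
  | _ => W6
  end.

Definition V_var (j : 'I_8) : variety := HSP1 (V_lattice j).

Definition LmVm (K : 'I_10 -> lattice) (Y : variety) : Prop :=
  (exists i, Y = with_M (L_var K i)) \/ (exists j, Y = with_M (V_var j)).

(* Main.v *)
Require Import Defs.
From HB Require Import structures.
From mathcomp Require Import all_boot all_order.
From mathcomp Require Import boolp classical_sets filter.

Set Implicit Arguments.
Unset Strict Implicit.
Unset Printing Implicit Defensive.

Import Order.Theory.
Local Open Scope order_scope.

(** The statement is about the lattice Lambda of varieties, and the one deep
    fact behind it is congruence distributivity of lattices, which enters
    twice.

    First, if [A] lies in the join of [V] and [W], then [A] is a subdirect
    product of a member of [V] and a member of [W] ([in_var_join]): such
    subdirect products form a variety because, when [A] is divided by a
    congruence [theta], distributivity gives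
    [theta = (theta \/ alpha) /\ (theta \/ beta)] as soon as
    [alpha /\ beta = 0].  Hence Lambda is distributive
    ([var_meet_join_distr]).

    Second, if [L] is finite, two distinct elements of a member [A] of HSP(L)
    are separated by a quotient of [A] that lies in HS(L) ([jonsson]).  Hence
    a subvariety of HSP(L) is controlled by the subquotients of [L].

    Write [O] for the join of N5 and the modular variety M.  Every nonmodular
    lattice contains the pentagon, so every variety that is not below M is
    above N5, and [O] is the only cover of M.  For each of the thirteen
    explicit lattices [D], a finite computation shows that every subquotient
    of [D] is isomorphic to [D] or lies in [O] ([HS_diagram]): each maximal
    proper sublattice of [D], and the quotient of [D] by its least nontrivial
    congruence, is separated by homomorphisms to the pentagon and the diamond
    M3.  So a subvariety of HSP(D) contains [D] or is below [O]
    ([check_atomic]).  For the other ten lattices this follows from their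
    being subdirectly irreducible generators of covers of N5
    ([cover_atomic]).  With distributivity, the join of HSP(L) and M then
    covers [O] for each of the 23 lattices ([with_M_covers]).

    The 23 covers are pairwise distinct.  Among the explicit lattices, equal
    varieties would force mutual embeddings, hence an isomorphism, and a
    numerical invariant excludes this ([listed_inj]).  The varieties of the
    ten abstract lattices differ from each other and from those of the [L_i]
    by assumption, and from those of the [V_j] because the latter contain M3,
    which a cover of N5 generated by a join-prime lattice outside [O] does not
    ([K_neq_V]).
    Finally, any finite set of covers of an element of a distributive lattice
    generates a Boolean lattice that is an interval ([boolean_interval]). *)

(** * Homomorphisms, products, sublattices and quotients *)

Lemma homI (A B : lattice) (f : {lmorphism A -> B}) x y :
  f (x `&` y) = f x `&` f y.
Proof. exact: omorphI. Qed.

Lemma homU (A B : lattice) (f : {lmorphism A -> B}) x y :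
  f (x `|` y) = f x `|` f y.
Proof. exact: omorphU. Qed.

Section MakeHom.
Variables (A B : lattice) (f : A -> B).
Hypothesis fI : forall x y, f (x `&` y) = f x `&` f y.
Hypothesis fU : forall x y, f (x `|` y) = f x `|` f y.

Let f_nondecreasing : {homo f : x y / x <= y}.
Proof. by move=> x y xy; rewrite leEmeet -fI (meet_l xy). Qed.

Definition hom : A -> B := f.
HB.instance Definition _ :=
  Order.isOrderMorphism.Build _ A _ B hom f_nondecreasing.
HB.instance Definition _ := Order.isLatticeMorphism.Build _ A _ B hom fI fU.
Definition mkhom : {lmorphism A -> B} := hom.
Lemma mkhomE x : mkhom x = f x. Proof. by []. Qed.
End MakeHom.

Section HomComp.
Variables A B C : lattice.
Definition hom_id : {lmorphism A -> A} :=
  @mkhom A A id (fun _ _ => erefl) (fun _ _ => erefl).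
Definition hom_comp (g : {lmorphism B -> C}) (f : {lmorphism A -> B}) :
  {lmorphism A -> C}.
Proof.
by apply: (@mkhom A C (fun x => g (f x))) => x y; rewrite ?homI ?homU.
Defined.
Lemma hom_compE g f x : hom_comp g f x = g (f x). Proof. by []. Qed.
End HomComp.

(** Lattices given by operations and identities.  Products, sublattices and
    quotients are built in this form because their order is then read off from
    the meet. *)
Record lattice_ops := LatticeOps {
  carrier : Type;
  opI : carrier -> carrier -> carrier;
  opU : carrier -> carrier -> carrier;
  opIC : commutative opI;
  opUC : commutative opU;
  opIA : associative opI;
  opUA : associative opU;
  opUKI : forall y x, opI x (opU x y) = x;
  opIKU : forall y x, opU x (opI x y) = x
}.

Section LatticeOfOps.
Variable O : lattice_ops.
Definition opsT : Type := carrier O.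
HB.instance Definition _ := gen_eqMixin opsT.
HB.instance Definition _ := gen_choiceMixin opsT.

Let m : opsT -> opsT -> opsT := @opI O.
Let ople (x y : opsT) : bool := m x y == x.

Let opxx x : m x x = x.
Proof. by rewrite /m -{2}(opIKU x x) opUKI. Qed.

Let ople_refl : reflexive ople.
Proof. by move=> x; rewrite /ople opxx. Qed.
Let ople_anti : antisymmetric ople.
Proof. by move=> x y /andP[/eqP xy /eqP yx]; rewrite -xy -[RHS]yx /m opIC. Qed.
Let ople_trans : transitive ople.
Proof.
move=> y x z /eqP xy /eqP yz; apply/eqP.
by rewrite -[in LHS]xy /m -opIA; move: yz; rewrite /m => ->.
Qed.

HB.instance Definition _ :=
  Order.Le_isPOrder.Build (Order.Disp tt tt) opsT
    ople_refl ople_anti ople_trans.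
HB.instance Definition _ :=
  Order.POrder_isLattice.Build (Order.Disp tt tt) opsT
    (@opIC O) (@opUC O) (@opIA O) (@opUA O) (@opUKI O) (@opIKU O)
    (fun x y => erefl).
Definition ops_lattice : lattice := opsT.
End LatticeOfOps.

Section Product.
Variables (I : Type) (A : I -> lattice).
Let T := forall i, A i.
Definition prod_ops : lattice_ops.
Proof.
refine (@LatticeOps T (fun x y i => x i `&` y i) (fun x y i => x i `|` y i)
  _ _ _ _ _ _); repeat (let x := fresh in move=> x);
  apply: functional_extensionality_dep => i.
- exact: meetC.
- exact: joinC.
- exact: meetA.
- exact: joinA.
- exact: joinKI.
- exact: meetKU.
Defined.
Definition prod_lattice : lattice := ops_lattice prod_ops.
Definition proj (i : I) : {lmorphism prod_lattice -> A i} :=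
  @mkhom prod_lattice (A i) (fun x => x i)
    (fun _ _ => erefl) (fun _ _ => erefl).
Definition tuple_of (x : forall i, A i) : prod_lattice := x.
Lemma projE i x : proj i (tuple_of x) = x i. Proof. by []. Qed.
Lemma prod_ext (x y : prod_lattice) : (forall i, proj i x = proj i y) -> x = y.
Proof. exact: functional_extensionality_dep. Qed.

Definition hom_tuple (C : lattice) (f : forall i, {lmorphism C -> A i}) :
  {lmorphism C -> prod_lattice}.
Proof.
apply: (@mkhom C prod_lattice (fun x => tuple_of (fun i => f i x))) => x y.
  by apply: prod_ext => i; rewrite homI !projE homI.
by apply: prod_ext => i; rewrite homU !projE homU.
Defined.
Lemma hom_tupleE C (f : forall i, {lmorphism C -> A i}) i x :
  proj i (hom_tuple f x) = f i x.
Proof. by []. Qed.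

Lemma var_prod (V : variety) : (forall i, V (A i)) -> V prod_lattice.
Proof.
move=> VA; have [_ _] := varietyP V; apply.
exists I, A, proj; split=> // x; exists (tuple_of x); split=> // y yx.
by apply: prod_ext => i; rewrite yx.
Qed.
End Product.

Arguments proj {I A} i.

Lemma sval_inj (T : Type) (P : T -> Prop) (x y : {x | P x}) :
  sval x = sval y -> x = y.
Proof. by case: x y => x Px [y Py] /= xy; apply: eq_exist. Qed.

Section Sublattice.
Variables (A : lattice) (P : A -> Prop).
Hypothesis PI : forall x y, P x -> P y -> P (x `&` y).
Hypothesis PU : forall x y, P x -> P y -> P (x `|` y).
Definition sub_ops : lattice_ops.
Proof.
refine (@LatticeOps {x : A | P x}
  (fun x y => exist _ (sval x `&` sval y) (PI (svalP x) (svalP y)))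
  (fun x y => exist _ (sval x `|` sval y) (PU (svalP x) (svalP y)))
  _ _ _ _ _ _); repeat (let x := fresh in move=> x); apply: sval_inj => /=.
- exact: meetC.
- exact: joinC.
- exact: meetA.
- exact: joinA.
- exact: joinKI.
- exact: meetKU.
Defined.
Definition sub_lattice : lattice := ops_lattice sub_ops.
Definition incl : {lmorphism sub_lattice -> A} :=
  @mkhom sub_lattice A (fun x => sval x) (fun _ _ => erefl) (fun _ _ => erefl).
Lemma incl_inj : injective incl. Proof. by move=> x y /sval_inj. Qed.
Lemma inclP x : P (incl x). Proof. exact: svalP. Qed.
Lemma incl_surj a : P a -> exists x, incl x = a.
Proof. by move=> Pa; exists (exist _ a Pa). Qed.
End Sublattice.

Record congruence (A : lattice) := Congruence {
  crel :> A -> A -> Prop;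
  crefl : forall x, crel x x;
  csym : forall x y, crel x y -> crel y x;
  ctrans : forall x y z, crel x y -> crel y z -> crel x z;
  crelI : forall x y x' y',
    crel x x' -> crel y y' -> crel (x `&` y) (x' `&` y');
  crelU : forall x y x' y',
    crel x x' -> crel y y' -> crel (x `|` y) (x' `|` y')
}.

(** A choice that depends only on the extension of the predicate, so that
    congruent elements receive the same representative. *)
Definition pick_of (T : Type) (P : T -> Prop) (e : exists x, P x) : T :=
  sval (cid e).
Lemma pick_of_eq (T : Type) (P Q : T -> Prop) (e : exists x, P x)
  (e' : exists x, Q x) : P = Q -> pick_of e = pick_of e'.
Proof. by move=> PQ; case: _ / PQ in e' *; rewrite (Prop_irrelevance e e'). Qed.

Section Quotient.
Variables (A : lattice) (th : congruence A).

Definition repr_of (x : A) : A := pick_of (ex_intro (th x) x (crefl th x)).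
Lemma repr_ofP x : th x (repr_of x).
Proof. exact: (svalP (cid (ex_intro (th x) x (crefl th x)))). Qed.
Lemma repr_of_eq x y : th x y -> repr_of x = repr_of y.
Proof.
move=> xy; apply: pick_of_eq.
by apply/predeqP=> z; split; apply: ctrans => //; exact: csym.
Qed.
Lemma repr_of_idem x : repr_of (repr_of x) = repr_of x.
Proof. by rewrite -(repr_of_eq (repr_ofP x)). Qed.
Lemma repr_of_inj x y : repr_of x = repr_of y -> th x y.
Proof.
by move=> xy; apply: ctrans (repr_ofP x) _; rewrite xy; apply/csym/repr_ofP.
Qed.
Definition quotT := {x : A | repr_of x = x}.
Definition toquot (x : A) : quotT := exist _ (repr_of x) (repr_of_idem x).
Lemma toquotP x y : toquot x = toquot y <-> th x y.
Proof.
split=> [/(congr1 sval) /= /repr_of_inj //|xy].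
by apply: eq_exist => /=; apply: repr_of_eq.
Qed.
Lemma toquotK (x : quotT) : toquot (sval x) = x.
Proof. by case: x => x rx; apply: eq_exist. Qed.
Definition quotI (x y : quotT) := toquot (sval x `&` sval y).
Definition quotU (x y : quotT) := toquot (sval x `|` sval y).
Lemma toquotI x y : toquot (x `&` y) = quotI (toquot x) (toquot y).
Proof. by apply/toquotP/crelI; apply: repr_ofP. Qed.
Lemma toquotU x y : toquot (x `|` y) = quotU (toquot x) (toquot y).
Proof. by apply/toquotP/crelU; apply: repr_ofP. Qed.
Definition quot_ops : lattice_ops.
Proof.
refine (@LatticeOps quotT quotI quotU _ _ _ _ _ _);
  repeat (let x := fresh in move=> x; rewrite -(toquotK x));
  rewrite -!(toquotI, toquotU); congr toquot.
- exact: meetC.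
- exact: joinC.
- exact: meetA.
- exact: joinA.
- exact: joinKI.
- exact: meetKU.
Defined.
Definition quot_lattice : lattice := ops_lattice quot_ops.
Definition quot_map : {lmorphism A -> quot_lattice} :=
  @mkhom A quot_lattice toquot toquotI toquotU.
Lemma quot_map_eq x y : quot_map x = quot_map y <-> th x y.
Proof. exact: toquotP. Qed.
Lemma quot_map_surj q : exists x, quot_map x = q.
Proof. by exists (sval (q : quotT)); apply: toquotK. Qed.
End Quotient.

Definition surj (A B : lattice) (f : A -> B) := forall b, exists a, f a = b.

Section Factor.
Variables (A B D : lattice) (p : {lmorphism A -> B}) (h : {lmorphism A -> D}).
Hypothesis ps : surj p.
Hypothesis ph : forall x y, p x = p y -> h x = h y.
Lemma factor : exists g : {lmorphism B -> D}, forall x, g (p x) = h x.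
Proof.
have [s sK] := choice ps.
have gp x : h (s (p x)) = h x by apply: ph; rewrite sK.
have gI x y : h (s (x `&` y)) = h (s x) `&` h (s y).
  by rewrite -homI; apply: ph; rewrite homI !sK.
have gU x y : h (s (x `|` y)) = h (s x) `|` h (s y).
  by rewrite -homU; apply: ph; rewrite homU !sK.
by exists (mkhom gI gU).
Qed.
End Factor.

Section KerFamily.
Variables (A : lattice) (I : Type) (B : I -> lattice)
  (f : forall i, {lmorphism A -> B i}).
Definition ker : congruence A.
Proof.
refine (@Congruence A (fun x y => forall i, f i x = f i y) _ _ _ _ _) => //.
- by move=> x y z xy yz i; rewrite xy.
- by move=> x y x' y' xx yy i; rewrite !homI xx yy.
- by move=> x y x' y' xx yy i; rewrite !homU xx yy.
Defined.
End KerFamily.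
Definition ker1 (A B : lattice) (f : {lmorphism A -> B}) : congruence A :=
  ker (fun _ : unit => f).

(** * Membership in a variety *)

Lemma var_sub (V : variety) (A B : lattice) (f : {lmorphism A -> B}) :
  injective f -> V B -> V A.
Proof. by move=> fi VB; have [_ h _] := varietyP V; apply: h; exists B, f. Qed.
Lemma var_img (V : variety) (A B : lattice) (f : {lmorphism A -> B}) :
  surj f -> V A -> V B.
Proof. by move=> fi VB; have [h _ _] := varietyP V; apply: h; exists A, f. Qed.

(** All three closure properties at once: [A] modulo the common kernel of the
    [f i] embeds in the product of the [B i], and [D] is a quotient of it. *)
Lemma var_of_family (V : variety) (A D : lattice) (I : Type)
    (B : I -> lattice) (f : forall i, {lmorphism A -> B i})
    (h : {lmorphism A -> D}) :
  (forall i, V (B i)) -> surj h ->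
  (forall x y, (forall i, f i x = f i y) -> h x = h y) -> V D.
Proof.
move=> VB hs fh; set th := ker f.
have [g gE] : exists g : {lmorphism quot_lattice th -> D},
    forall x, g (quot_map th x) = h x.
  by apply: factor (@quot_map_surj _ _) _ => x y /quot_map_eq; apply: fh.
have [e eE] : exists e : {lmorphism quot_lattice th -> prod_lattice B},
    forall x, e (quot_map th x) = hom_tuple f x.
  apply: factor (@quot_map_surj _ _) _ => x y /quot_map_eq xy.
  by apply: prod_ext => i; rewrite !hom_tupleE xy.
apply: (@var_img V _ _ g) => [d|].
  by have [a ad] := hs d; exists (quot_map th a); rewrite gE.
apply: (@var_sub V _ _ e); last exact: var_prod.
move=> q q'; have [x <-] := quot_map_surj q; have [y <-] := quot_map_surj q'.
rewrite !eE => xy; apply/quot_map_eq => i.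
by have := congr1 (@proj _ B i) xy.
Qed.

Lemma var_of_separating (V : variety) (A : lattice) :
  (forall x y : A, x <> y -> exists (B : lattice) (f : {lmorphism A -> B}),
     V B /\ f x <> f y) -> V A.
Proof.
move=> sep.
pose I := {p : A * A | p.1 <> p.2}.
pose B (i : I) := projT1 (cid (sep _ _ (svalP i))).
pose hB (i : I) := cid (projT2 (cid (sep _ _ (svalP i)))).
pose f i : {lmorphism A -> B i} := projT1 (hB i).
have fP i : V (B i) /\ f i (sval i).1 <> f i (sval i).2 := projT2 (hB i).
apply: (@var_of_family V A A I B f (hom_id A)).
- by move=> i; case: (fP i).
- by move=> a; exists a.
- move=> x y xy; apply: contrapT => nxy.
  by have [_ /=] := fP (exist (fun p : A * A => p.1 <> p.2) (x, y) nxy).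
Qed.

(** * Congruence distributivity *)

Section CongruenceJoin.
Variables (A : lattice) (al be : congruence A).

(** Zigzags along two congruences: their transitive closure is the join. *)
Inductive linked : A -> A -> Prop :=
| linked0 x : linked x x
| linkedl x y z : al x y -> linked y z -> linked x z
| linkedr x y z : be x y -> linked y z -> linked x z.

Lemma linked_trans x y z : linked x y -> linked y z -> linked x z.
Proof.
elim=> [//|x' y' z' xy _ IH /IH|x' y' z' xy _ IH /IH]; first exact: linkedl.
exact: linkedr.
Qed.
Lemma linkedL x y : al x y -> linked x y.
Proof. by move=> xy; apply: linkedl xy (linked0 _). Qed.
Lemma linkedR x y : be x y -> linked x y.
Proof. by move=> xy; apply: linkedr xy (linked0 _). Qed.
Lemma linked_sym x y : linked x y -> linked y x.
Proof.
elim=> [x'|x' y' z' xy _ IH|x' y' z' xy _ IH]; first exact: linked0.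
  by apply: linked_trans IH _; apply/linkedL/csym.
by apply: linked_trans IH _; apply/linkedR/csym.
Qed.
Lemma linkedI z x y : linked x y -> linked (x `&` z) (y `&` z).
Proof.
elim=> [x'|x' y' z' xy _ IH|x' y' z' xy _ IH]; first exact: linked0.
  by apply: linkedl IH; apply: crelI (crefl _ _).
by apply: linkedr IH; apply: crelI (crefl _ _).
Qed.
Lemma linkedU z x y : linked x y -> linked (x `|` z) (y `|` z).
Proof.
elim=> [x'|x' y' z' xy _ IH|x' y' z' xy _ IH]; first exact: linked0.
  by apply: linkedl IH; apply: crelU (crefl _ _).
by apply: linkedr IH; apply: crelU (crefl _ _).
Qed.

Definition cjoin : congruence A.
Proof.
refine (@Congruence A linked linked0 linked_sym linked_trans _ _).
- move=> x y x' y' xx yy; apply: (linked_trans (linkedI y xx)).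
  by rewrite ![x' `&` _]meetC; apply: linkedI.
- move=> x y x' y' xx yy; apply: (linked_trans (linkedU y xx)).
  by rewrite ![x' `|` _]joinC; apply: linkedU.
Defined.
End CongruenceJoin.

(** A majority term: it returns the repeated value whenever two of its
    arguments agree.  Its existence is what makes congruence lattices of
    lattices distributive. *)
Definition median (A : lattice) (x y z : A) : A :=
  (x `&` y) `|` (y `&` z) `|` (z `&` x).

Lemma median_cong (A : lattice) (th : congruence A) x y z y' :
  th y y' -> th (median x y z) (median x y' z).
Proof.
move=> yy; have r := crefl th.
by apply: crelU (crelU (crelI (r _) yy) (crelI yy (r _))) (r _).
Qed.
Lemma median_cong3 (A : lattice) (th : congruence A) x y z z' :
  th z z' -> th (median x y z) (median x y z').
Proof.
move=> zz; have r := crefl th.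
by apply: crelU (crelU (r _) (crelI (r _) zz)) (crelI zz (r _)).
Qed.
Lemma medianxxy (A : lattice) (x y : A) : median x x y = x.
Proof. by rewrite /median meetxx meetKU meetKUC. Qed.
Lemma medianxyy (A : lattice) (x y : A) : median x y y = y.
Proof. by rewrite /median meetxx meetUK meetKU. Qed.
Lemma medianxyx (A : lattice) (x y : A) : median x y x = x.
Proof. by rewrite /median meetxx -joinA meetUK meetUKC. Qed.

Definition cmeet (A : lattice) (al be : congruence A) : congruence A.
Proof.
refine (@Congruence A (fun x y => al x y /\ be x y) _ _ _ _ _).
- by split; apply: crefl.
- by move=> x y [? ?]; split; apply: csym.
- by move=> x y z [? ?] [? ?]; split; apply: ctrans; eassumption.
- by move=> x y x' y' [? ?] [? ?]; split; apply: crelI.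
- by move=> x y x' y' [? ?] [? ?]; split; apply: crelU.
Defined.

Lemma cjoin_mono (A : lattice) (al be al' be' : congruence A) x y :
  (forall u v, al u v -> al' u v) -> (forall u v, be u v -> be' u v) ->
  cjoin al be x y -> cjoin al' be' x y.
Proof.
move=> aa bb; elim=> [u|u v w uv _|u v w uv _]; first exact: crefl.
  by apply: linkedl; apply: aa.
by apply: linkedr; apply: bb.
Qed.

(** In a zigzag from [x] to [y], replace each point [u] by [median x u y].
    The new zigzag still joins [x] to [y], and all its points are congruent to
    [x] modulo [psi] because [x] and [y] are; so each of its steps lies in
    [psi] as well. *)
Lemma cmeet_cjoin (A : lattice) (psi th al : congruence A) x y :
  cmeet psi (cjoin th al) x y -> cjoin (cmeet psi th) (cmeet psi al) x y.
Proof.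
move=> [pxy xy].
have pm u : psi (median x u y) x.
  by rewrite -[X in psi _ X](medianxyx x u); apply/median_cong3/csym.
have pmm u v : psi (median x u y) (median x v y).
  exact: ctrans (pm _) (csym (pm _)).
have: forall u v, cjoin th al u v ->
    cjoin (cmeet psi th) (cmeet psi al) (median x u y) (median x v y).
  move=> u v; elim=> [w|u' v' w uv _|u' v' w uv _]; first exact: crefl.
    by apply: linkedl; split; [apply: pmm | apply: median_cong].
  by apply: linkedr; split; [apply: pmm | apply: median_cong].
by move/(_ _ _ xy); rewrite medianxxy medianxyy.
Qed.

(** The dual distributive law, obtained by using [cmeet_cjoin] twice. *)
Lemma cjoin_cmeet (A : lattice) (th al be : congruence A) x y :
  cjoin th al x y -> cjoin th be x y -> cjoin th (cmeet al be) x y.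
Proof.
move=> xya xyb; have : cmeet (cjoin th be) (cjoin th al) x y by [].
move/cmeet_cjoin; elim=> [u|u v w [_ uv] _|u v w [buv auv] _].
- exact: crefl.
- exact: linkedl.
apply: linked_trans; have : cmeet al (cjoin th be) u v by [].
by move/cmeet_cjoin; apply: cjoin_mono => [? ? []|? ?].
Qed.

(** * Joins of varieties *)

Section Subdirect.
Variables V W : variety.

Definition jointly_embeds (A : lattice) : Prop :=
  exists (B C : lattice) (f : {lmorphism A -> B}) (g : {lmorphism A -> C}),
    [/\ V B, W C & forall x y, f x = f y -> g x = g y -> x = y].

(** Only quotients are delicate.  If [theta] is the kernel of a quotient map
    [q] and [f], [g] are jointly injective, then [cjoin_cmeet] shows that
    [theta] is the intersection of its joins with the kernels of [f] and [g],
    so the quotient embeds in the product of the two larger quotients. *)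
Lemma jointly_embeds_is_variety : is_variety jointly_embeds.
Proof.
split=> A.
- move=> [A' [q [[B [C [f [g [VB WC fg]]]]] qs]]].
  pose th := ker1 q; pose al := cjoin th (ker1 f); pose be := cjoin th (ker1 g).
  have qal x y : q x = q y -> quot_map al x = quot_map al y.
    by move=> xy; apply/quot_map_eq/linkedL => _.
  have qbe x y : q x = q y -> quot_map be x = quot_map be y.
    by move=> xy; apply/quot_map_eq/linkedL => _.
  have [f' f'E] := factor qs qal; have [g' g'E] := factor qs qbe.
  exists (quot_lattice al), (quot_lattice be), f', g'; split.
  + apply: (@var_of_family V _ _ unit _ (fun=> f) (quot_map al)) => //.
      exact: quot_map_surj.
    by move=> x y /(_ tt) xy; apply/quot_map_eq/linkedR => _.
  + apply: (@var_of_family W _ _ unit _ (fun=> g) (quot_map be)) => //.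
      exact: quot_map_surj.
    by move=> x y /(_ tt) xy; apply/quot_map_eq/linkedR => _.
  + move=> x y; have [a <-] := qs x; have [b <-] := qs y.
    rewrite !f'E !g'E => /quot_map_eq ab /quot_map_eq /(cjoin_cmeet ab).
    elim=> [//|u v w /(_ tt) -> //|u v w [/(_ tt) uf /(_ tt) ug] _ <-].
    by rewrite (fg _ _ uf ug).
- move=> [A' [i [[B [C [f [g [VB WC fg]]]]] ii]]].
  exists B, C, (hom_comp f i), (hom_comp g i); split=> // x y xf xg.
  by apply/ii/fg.
- move=> [I [D [p [hD pb]]]].
  (* The two factors and the two maps are chosen for each index. *)
  pose cB i := cid (hD i); pose B i := projT1 (cB i).
  pose cC i := cid (projT2 (cB i)); pose C i := projT1 (cC i).
  pose cf i := cid (projT2 (cC i)).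
  pose f i : {lmorphism D i -> B i} := projT1 (cf i).
  pose cg i := cid (projT2 (cf i)).
  pose g i : {lmorphism D i -> C i} := projT1 (cg i).
  have fgP i : [/\ V (B i), W (C i) &
      forall x y, f i x = f i y -> g i x = g i y -> x = y].
    exact: projT2 (cg i).
  exists (prod_lattice B), (prod_lattice C).
  exists (hom_tuple (fun i => hom_comp (f i) (p i))).
  exists (hom_tuple (fun i => hom_comp (g i) (p i))); split.
  + by apply: var_prod => i; case: (fgP i).
  + by apply: var_prod => i; case: (fgP i).
  + move=> x y xf xg; have [b [_ ub]] := pb (fun i => p i x).
    rewrite -(ub x) //; apply: ub => i; have [_ _ fg] := fgP i.
    symmetry; apply: fg.
      by have := congr1 (@proj _ B i) xf.
    by have := congr1 (@proj _ C i) xg.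
Qed.

End Subdirect.

Lemma var_le_joinl (V W : variety) : var_le V (var_join V W).
Proof. by move=> A VA U [_]; apply; left. Qed.
Lemma var_le_joinr (V W : variety) : var_le W (var_join V W).
Proof. by move=> A VA U [_]; apply; right. Qed.
Lemma var_join_le (V W U : variety) :
  var_le V U -> var_le W U -> var_le (var_join V W) U.
Proof.
move=> VU WU A; apply; split; first exact: varietyP.
by move=> B [/VU|/WU].
Qed.

(** The empty product, used as a trivial second factor. *)
Definition one_lattice : lattice :=
  prod_lattice (fun i : void => match i with end).
Lemma var_one (V : variety) : V one_lattice.
Proof. by apply: var_prod; case. Qed.
Definition to_one (A : lattice) : {lmorphism A -> one_lattice} :=
  hom_tuple (fun i : void => match i with end).

(** Members of a join of two varieties are subdirect products of a member of
    each; a form of Jonsson's lemma. *)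
Lemma in_var_join (V W : variety) (A : lattice) :
  var_join V W A <-> exists (B C : lattice) (f : {lmorphism A -> B})
    (g : {lmorphism A -> C}),
    [/\ surj f, surj g, V B, W C & forall x y, f x = f y -> g x = g y -> x = y].
Proof.
split=> [|[B [C [f [g [_ _ VB WC fg]]]]]].
  case/(_ (jointly_embeds V W)) => [|B [C [f [g [VB WC fg]]]]].
    split=> [|B [VB|WB]]; first exact: jointly_embeds_is_variety.
      exists B, one_lattice, (hom_id B), (to_one B).
      by split=> //; apply: var_one.
    exists one_lattice, B, (to_one B), (hom_id B).
    by split=> //; apply: var_one.
  exists (quot_lattice (ker1 f)), (quot_lattice (ker1 g)).
  exists (quot_map _), (quot_map _).
  split; try exact: quot_map_surj.
  - apply: (@var_of_family V _ _ unit _ (fun=> f) (quot_map (ker1 f))) => //.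
      exact: quot_map_surj.
    by move=> x y xy; apply/quot_map_eq.
  - apply: (@var_of_family W _ _ unit _ (fun=> g) (quot_map (ker1 g))) => //.
      exact: quot_map_surj.
    by move=> x y xy; apply/quot_map_eq.
  - by move=> x y /quot_map_eq /(_ tt) xf /quot_map_eq /(_ tt); apply: fg.
apply: (@var_of_separating (var_join V W)) => x y xy.
have [xf|xf] := pselect (f x = f y); last first.
  by exists B, f; split=> //; apply: var_le_joinl.
by exists C, g; split=> [|xg]; [apply: var_le_joinr | apply/xy/fg].
Qed.

Lemma var_le_refl V : var_le V V. Proof. by []. Qed.
Lemma var_le_trans U V W : var_le U V -> var_le V W -> var_le U W.
Proof. by move=> UV VW A /UV /VW. Qed.
Lemma var_le_anti V W : var_le V W -> var_le W V -> V = W.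
Proof.
case: V W => [V Vv] [W Wv] VW WV.
have E : V = W by apply/predeqP => A; split; [apply: VW | apply: WV].
by case: _ / E in Wv VW WV *; rewrite (Prop_irrelevance Vv Wv).
Qed.

(** The two subdirect factors of a member of [U] are quotients of it, hence
    belong to [U]. *)
Lemma var_meet_join_distr (U V W : variety) :
  var_le (var_meet U (var_join V W)) (var_join (var_meet U V) (var_meet U W)).
Proof.
move=> A [UA /in_var_join[B [C [f [g [fs gs VB WC fg]]]]]].
apply/in_var_join; exists B, C, f, g; split=> //; split=> //.
  exact: var_img UA.
exact: var_img UA.
Qed.

(** * The variety generated by a finite lattice *)

Section Generated.
Variable L : lattice.

(** Membership in HSP(L) without mentioning powers of [L]: the lattice [C]
    embeds in a power of [L] exactly when homomorphisms to [L] separate its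
    points. *)
Definition hsp_form (A : lattice) : Prop :=
  exists (C : lattice) (q : {lmorphism C -> A}),
    surj q /\
    forall x y : C, (forall h : {lmorphism C -> L}, h x = h y) -> x = y.

Lemma hsp_form_is_variety : is_variety hsp_form.
Proof.
split=> A.
- move=> [A' [f [[C [q [qs sep]]] fs]]]; exists C, (hom_comp f q); split=> // a.
  by have [a' <-] := fs a; have [c <-] := qs a'; exists c.
- move=> [A' [f [[C [q [qs sep]]] fi]]].
  (* A sublattice of a quotient is a quotient of its full preimage. *)
  pose P c := exists a, f a = q c.
  have PI x y : P x -> P y -> P (x `&` y).
    by move=> [a fa] [b fb]; exists (a `&` b); rewrite !homI fa fb.
  have PU x y : P x -> P y -> P (x `|` y).
    by move=> [a fa] [b fb]; exists (a `|` b); rewrite !homU fa fb.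
  pose j := incl PI PU.
  have [r rE] := choice (fun x => inclP x : exists a, f a = q (j x)).
  have rI x y : r (x `&` y) = r x `&` r y.
    by apply: fi; rewrite homI !rE !homI.
  have rU x y : r (x `|` y) = r x `|` r y.
    by apply: fi; rewrite homU !rE !homU.
  exists (sub_lattice PI PU), (mkhom rI rU); split.
  + move=> a; have [c qc] := qs (f a).
    have [x xc] : exists x, j x = c by apply: incl_surj; exists a.
    by exists x; rewrite mkhomE; apply: fi; rewrite rE xc.
  + move=> x y xy; apply: (@incl_inj _ _ PI PU); apply: sep => h.
    exact: (xy (hom_comp h j)).
- move=> [I [D [p [hD pb]]]].
  pose cC i := cid (hD i); pose C i := projT1 (cC i).
  pose cq i := cid (projT2 (cC i)).
  pose q i : {lmorphism C i -> D i} := projT1 (cq i).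
  have qP i : surj (q i) /\ forall x y : C i,
    (forall h : {lmorphism C i -> L}, h x = h y) -> x = y := projT2 (cq i).
  have p_inj x y : (forall i, p i x = p i y) -> x = y.
    move=> xy; have [b [_ ub]] := pb (fun i => p i x).
    by rewrite -(ub x) //; apply: ub => i; rewrite xy.
  have pb' (c : prod_lattice C) : exists a, forall i, p i a = q i (proj i c).
    by have [b [pb1 _]] := pb (fun i => q i (proj i c)); exists b.
  have [r rE] := choice pb'.
  have rI x y : r (x `&` y) = r x `&` r y.
    by apply: p_inj => i; rewrite homI !rE !homI.
  have rU x y : r (x `|` y) = r x `|` r y.
    by apply: p_inj => i; rewrite homU !rE !homU.
  exists (prod_lattice C), (mkhom rI rU); split.
  + move=> a; pose c i := sval (cid ((qP i).1 (p i a))).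
    exists (tuple_of c); rewrite mkhomE; apply: p_inj => i.
    by rewrite rE projE; apply: (svalP (cid ((qP i).1 (p i a)))).
  + move=> x y xy; apply: prod_ext => i; apply: (qP i).2 => h.
    exact: (xy (hom_comp h (proj i))).
Qed.

Lemma HSP1_hsp_form A : HSP1 L A -> hsp_form A.
Proof.
apply; split; first exact: hsp_form_is_variety.
move=> _ ->; exists L, (hom_id L); split=> [x|x y]; first by exists x.
by move/(_ (hom_id L)).
Qed.

Lemma in_HSP1 : HSP1 L L.
Proof. by move=> V [_]; apply. Qed.

Lemma HSP1_le (V : variety) : V L -> var_le (HSP1 L) V.
Proof. by move=> VL A; apply; split=> [|_ ->]; first exact: varietyP. Qed.

(** Membership in HS(L): the sublattice of [L] is the image of [h], and [p]
    factors through it. *)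
Definition HS_of (D : lattice) : Prop :=
  exists (C : lattice) (h : {lmorphism C -> L}) (p : {lmorphism C -> D}),
    surj p /\ forall x y, h x = h y -> p x = p y.

Section Agree.
Variables (C : lattice) (J : set {lmorphism C -> L}).
Definition agree : congruence C := ker (fun i : {h | J h} => sval i).
Lemma agreeP x y : agree x y <-> forall h, J h -> h x = h y.
Proof.
by split=> [xy h Jh|xy [h Jh]]; [apply: (xy (exist J h Jh)) | apply: xy].
Qed.
End Agree.

(** Write [A] as a quotient of [C] by [theta], where the set [I] of
    homomorphisms from [C] to [L] separates points, and let [b], [c] be
    distinct modulo [theta].  Call a set [J] of homomorphisms bad if [b] and
    [c] become congruent modulo the join of [theta] and agreement on [J].  By
    congruence distributivity the bad sets form an ideal; it is proper since
    agreement on [I] is equality.  An ultrafilter [U] avoiding this ideal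
    defines a map [V] from [C] to the ultrapower of [L], which is [L] itself
    because [L] is finite.  The quotient of [C] by the join of [theta] and the
    kernel of [V] separates [b] from [c]: a zigzag between them uses finitely
    many equalities, which hold simultaneously on a set of [U]. *)
Lemma jonsson (A : lattice) (x y : A) : finite_lattice L -> HSP1 L A ->
  x <> y -> exists (D : lattice) (r : {lmorphism A -> D}),
    [/\ HS_of D, surj r & r x <> r y].
Proof.
move=> [s sP] /HSP1_hsp_form[C [q [qs sep]]].
have [b <-] := qs x; have [c <-] := qs y => bc {x y}.
pose I := {lmorphism C -> L}; pose th := ker1 q.
pose bad (J : set I) := cjoin th (agree J) b c.
have bad_sub (J J' : set I) : (J `<=` J')%classic -> bad J' -> bad J.
  move=> JJ; apply: cjoin_mono => // u v /agreeP uv.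
  by apply/agreeP => h /JJ; apply: uv.
have badU (J J' : set I) : bad J -> bad J' -> bad (J `|` J')%classic.
  move=> bJ /(cjoin_cmeet bJ).
  apply: cjoin_mono => // u v [/agreeP uv /agreeP uv'].
  by apply/agreeP => h [/uv|/uv'].
have badT : ~ bad setT.
  have key u w : cjoin th (agree setT) u w -> q u = q w.
    elim=> [//|u' v w' /(_ tt) -> //|u' v w' /agreeP uv _ <-].
    by congr (q _); apply: sep => h; apply: uv.
  by move/key.
have bad0 : bad set0 by apply: linkedR; apply/agreeP.
pose F : set_system I := [set J | bad (~` J)]%classic.
have FF : ProperFilter F.
  split; first by rewrite /F /= setC0.
  split; first by rewrite /F /= setCT.
    by move=> J J' FJ FJ'; rewrite /F /= setCI; apply: badU.
  by move=> J J' JJ; apply: bad_sub; apply: subsetC.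
have [U [UU FU]] := ultraFilterLemma FF.
have U_bad J : U J -> ~ bad J.
  move=> UJ bJ; have UC : U (~` J)%classic by apply: FU; rewrite /F /= setCK.
  by apply: (@filter_not_empty _ U); rewrite -(setICr J); apply: filterI.
(* The ultrafilter selects one of the finitely many values at [z]. *)
have U_val z : exists l, U [set h : I | h z = l]%classic.
  have: U [set h : I | h z \in s]%classic.
    by apply: filterS filterT => h _; apply: sP.
  elim: s {sP} => [U0|l s IH Us].
    by case: (@filter_not_empty _ U); apply: filterS U0.
  have [Ul|Ul] := in_ultra_setVsetC [set h : I | h z = l]%classic UU.
    by exists l.
  apply: IH; apply: filterS (filterI Us Ul) => h [] /=.
  by rewrite inE => /orP[/eqP|].
have [v vP] := choice U_val.
have v_eq z l : U [set h : I | h z = l]%classic -> v z = l.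
  move=> Ul; have [h [<- <-//]] := filter_ex (filterI (vP z) Ul).
have vI u w : v (u `&` w) = v u `&` v w.
  apply: v_eq; apply: filterS (filterI (vP u) (vP w)) => h [/= hu hw].
  by rewrite homI hu hw.
have vU u w : v (u `|` w) = v u `|` v w.
  apply: v_eq; apply: filterS (filterI (vP u) (vP w)) => h [/= hu hw].
  by rewrite homU hu hw.
pose V : {lmorphism C -> L} := mkhom vI vU.
pose D := cjoin th (ker1 V).
have D_bad u w : D u w -> exists2 J, U J & cjoin th (agree J) u w.
  elim=> [t|u' t w' ut _ [J UJ IH]|u' t w' /(_ tt) ut _ [J UJ IH]].
  - by exists setT; [exact: filterT | exact: crefl].
  - by exists J => //; apply: linkedl IH.
  - set K := [set h : I | h u' = h t]%classic; exists (J `&` K)%classic.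
      apply: filterI => //.
      apply: filterS (filterI (vP u') (vP t)) => h [/= hu ht].
      by rewrite /K /= hu ht; apply: ut.
    apply: (@linkedr _ _ _ _ t); first by apply/agreeP => h [].
    apply: cjoin_mono IH => // a a' /agreeP aa.
    by apply/agreeP => h [/aa].
have [r rE] : exists r : {lmorphism A -> quot_lattice D},
    forall z, r (q z) = quot_map D z.
  by apply: factor => // u w uw; apply/quot_map_eq/linkedL => _.
exists (quot_lattice D), r; split.
- exists C, V, (quot_map D); split; first exact: quot_map_surj.
  by move=> u w uw; apply/quot_map_eq/linkedR => _.
- by move=> d; have [z <-] := quot_map_surj d; exists (q z).
- by rewrite !rE => /quot_map_eq /D_bad[J /U_bad].
Qed.
End Generated.

(** * Finite computations with diagrams *)

(** Elements of a diagram are handled through their numbers, so that checks on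
    all elements become computations on lists. *)
Definition idx (D : diagram) (x : D) : nat := nat_of_ord (x : 'I_(dsize D)).

Lemma idx_inj (D : diagram) : injective (@idx D).
Proof. exact: val_inj. Qed.
Lemma idx_lt (D : diagram) (x : D) : (idx x < dsize D)%N.
Proof. exact: ltn_ord. Qed.
Definition elt (D : diagram) (k : nat) (kn : (k < dsize D)%N) : D := Ordinal kn.
Lemma idx_elt (D : diagram) k (kn : (k < dsize D)%N) : idx (elt kn) = k.
Proof. by []. Qed.
Lemma diagram_finite (D : diagram) : finite_lattice D.
Proof. by exists (enum 'I_(dsize D)) => x; apply: mem_enum. Qed.

(** Operations are tabulated so that each value is computed only once. *)
Definition table (T : Type) n (op : nat -> nat -> T) : seq (seq T) :=
  mkseq (fun x => mkseq (op x) n) n.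
Definition look (T : Type) (d : T) (t : seq (seq T)) x y :=
  nth d (nth [::] t x) y.
Lemma lookE T (d : T) n op x y :
  (x < n)%N -> (y < n)%N -> look d (table n op) x y = op x y.
Proof. by move=> xn yn; rewrite /look !nth_mkseq. Qed.

Definition tabI (D : diagram) : nat -> nat -> nat :=
  look 0 (table (dsize D) (fun x y =>
    find (is_glb (dsize D) (dcov D) x y) (iota 0 (dsize D)))).
Definition tabU (D : diagram) : nat -> nat -> nat :=
  look 0 (table (dsize D) (fun x y =>
    find (is_lub (dsize D) (dcov D) x y) (iota 0 (dsize D)))).
Lemma tabIE (D : diagram) (x y : D) : tabI D (idx x) (idx y) = idx (x `&` y).
Proof. by rewrite /tabI lookE ?idx_lt. Qed.
Lemma tabUE (D : diagram) (x y : D) : tabU D (idx x) (idx y) = idx (x `|` y).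
Proof. by rewrite /tabU lookE ?idx_lt. Qed.

Definition all_lt n (P : nat -> bool) := all P (iota 0 n).
Lemma all_ltP n (P : pred nat) :
  reflect (forall x, (x < n)%N -> P x) (all_lt n P).
Proof.
apply: (iffP allP) => h x; last by rewrite mem_iota add0n => /h.
by move=> xn; apply: h; rewrite mem_iota add0n.
Qed.
Lemma all_idx (D : diagram) (P : pred nat) :
  all_lt (dsize D) P -> forall x : D, P (idx x).
Proof. by move/all_ltP => h x; apply/h/idx_lt. Qed.

Definition modular_diagram (D : diagram) : bool :=
  let mi := tabI D in let ji := tabU D in let n := dsize D in
  all_lt n (fun x => all_lt n (fun y => all_lt n (fun z =>
    (mi x z == x) ==> (ji x (mi y z) == mi (ji x y) z)))).

Lemma modular_diagramP (D : diagram) : modular_diagram D <-> modular D.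
Proof.
split=> [h x y z xz|h].
  apply: idx_inj; move: h; rewrite /modular_diagram.
  move/all_idx/(_ x)/all_idx/(_ y)/all_idx/(_ z).
  by rewrite !tabIE !tabUE !tabIE (meet_l xz) eqxx => /eqP.
apply/all_ltP => x xn; apply/all_ltP => y yn; apply/all_ltP => z zn.
have := idx_elt xn; have := idx_elt yn; have := idx_elt zn.
move: (elt xn) (elt yn) (elt zn) => a b c <- <- <-.
rewrite !tabIE !tabUE !tabIE.
by apply/implyP => /eqP/idx_inj/meet_idPl/h ->.
Qed.

Definition M3 :=
  @Diagram 5 [:: (0, 1); (0, 2); (0, 3); (1, 4); (2, 4); (3, 4)] erefl.
Lemma M3_modular : modular M3.
Proof. by apply/modular_diagramP; vm_compute. Qed.

Definition N5M : variety := with_M N5_var.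
Definition target (b : bool) : diagram := if b then M3 else N5.
Lemma target_N5M b : N5M (target b).
Proof.
case: b; first by apply: var_le_joinr; apply: M3_modular.
by apply: var_le_joinl; apply: in_HSP1.
Qed.

Section Forced.
Variables (n : nat) (mi ji : nat -> nat -> nat) (p q : nat).
(** [forced k] holds of those pairs whose identification by a homomorphism
    entails, within [k] translations by meets and joins, that of [p] and
    [q]. *)
Fixpoint forced (k : nat) : nat -> nat -> bool :=
  if k is k'.+1 then
    let G := forced k' in
    look false (table n (fun x y => has (fun c =>
      G (mi x c) (mi y c) || G (ji x c) (ji y c)) (iota 0 n)))
  else fun x y => (x == p) && (y == q) || (x == q) && (y == p).
End Forced.

Lemma forcedP (D : diagram) (p q : D) k (Q : lattice) (f : {lmorphism D -> Q}) :
  forall x y : D,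
  forced (dsize D) (tabI D) (tabU D) (idx p) (idx q) k (idx x) (idx y) ->
  f x = f y -> f p = f q.
Proof.
elim: k => [|k IH] x y /=.
  by case/orP=> /andP[/eqP/idx_inj -> /eqP/idx_inj ->].
rewrite lookE ?idx_lt // => /hasP[c]; rewrite mem_iota add0n => /andP[_ cn].
have := idx_elt cn; move: (elt cn) => z <-.
rewrite !tabIE !tabUE => /orP[] /IH h fxy; apply: h.
  by rewrite !homI fxy.
by rewrite !homU fxy.
Qed.

(** Enough translations for every use of [forced] on the diagrams below. *)
Definition rounds := 5.

(** The pair [uv] is identified by every noninjective homomorphism, so it
    generates the least nontrivial congruence. *)
Definition critical (D : diagram) (uv : nat * nat) : bool :=
  let n := dsize D in let G := forced n (tabI D) (tabU D) uv.1 uv.2 rounds in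
  [&& (uv.1 < n)%N, (uv.2 < n)%N, uv.1 != uv.2 &
    all_lt n (fun x => all_lt n (fun y => (x != y) ==> G x y))].

Lemma criticalP (D : diagram) uv : critical D uv ->
  exists u v : D, [/\ idx u = uv.1, idx v = uv.2, u <> v &
    forall (Q : lattice) (f : {lmorphism D -> Q}), f u <> f v -> injective f].
Proof.
case: uv => u' v' /and4P[/= un vn uv h].
exists (elt un), (elt vn); split=> //.
  by move/(congr1 (@idx D)); rewrite !idx_elt; apply/eqP.
move=> Q f fuv x y fxy; apply: contrapT => xy; apply: fuv.
apply: (@forcedP D (elt un) (elt vn) rounds _ _ x y) => //.
move/all_idx: h => /(_ x)/all_idx/(_ y)/implyP; apply.
by apply/eqP => /idx_inj.
Qed.

(** A partial map to a diagram is the list of its values.  Targets have at most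
    nine elements, so the value 9 stands for undefined. *)
Definition undef := 9.
Definition pval (s : seq nat) x := nth undef s x.
Definition phom (T : diagram) n (mi ji : nat -> nat -> nat) (s : seq nat) :
    bool :=
  let ti := tabI T in let tj := tabU T in
  let dom x := (pval s x < dsize T)%N in
  all_lt n (fun x => all_lt n (fun y => dom x && dom y ==>
    (pval s (mi x y) == ti (pval s x) (pval s y)) &&
    (pval s (ji x y) == tj (pval s x) (pval s y)))).

(** A partial homomorphism whose domain contains the image of [h] can be
    composed with [h]. *)
Lemma phomP (D T : diagram) s (C : lattice) (h : {lmorphism C -> D}) :
  phom T (dsize D) (tabI D) (tabU D) s ->
  (forall c, pval s (idx (h c)) < dsize T)%N ->
  exists f : {lmorphism C -> T}, forall c, idx (f c) = pval s (idx (h c)).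
Proof.
move=> s_hom dom; pose f c : T := elt (dom c).
have fI x y : f (x `&` y) = f x `&` f y.
  apply: idx_inj; rewrite -tabIE !idx_elt homI -tabIE.
  move/all_idx: s_hom => /(_ (h x))/all_idx/(_ (h y)).
  by rewrite !dom /= => /andP[/eqP].
have fU x y : f (x `|` y) = f x `|` f y.
  apply: idx_inj; rewrite -tabUE !idx_elt homU -tabUE.
  move/all_idx: s_hom => /(_ (h x))/all_idx/(_ (h y)).
  by rewrite !dom /= => /andP[_ /eqP].
by exists (mkhom fI fU) => c; rewrite mkhomE idx_elt.
Qed.

(** Partial maps to the pentagon or, when the flag is set, to the diamond. *)
Definition pmap := (bool * seq nat)%type.
Definition phom_ok n mi ji (t : pmap) := phom (target t.1) n mi ji t.2.
Definition fdom (F : seq pmap) x :=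
  all (fun t => (pval t.2 x < dsize (target t.1))%N) F.
Definition fsep (F : seq pmap) x y := has (fun t => pval t.2 x != pval t.2 y) F.

Section Family.
Variables (D : diagram) (F : seq pmap).
Hypothesis Fhom : all (phom_ok (dsize D) (tabI D) (tabU D)) F.
Variables (C Q : lattice) (h : {lmorphism C -> D}) (p : {lmorphism C -> Q}).
Hypothesis ps : surj p.
Hypothesis hF : forall c, fdom F (idx (h c)).
Hypothesis hp : forall c c', fsep F (idx (h c)) (idx (h c')) \/ p c = p c'.

(** This covers both ways of producing a subquotient in [N5M]: partial maps
    that separate the points of a sublattice, and total maps whose common
    kernel is contained in that of [p]. *)
Lemma family_N5M : N5M Q.
Proof.
have hom_of t : t \in F -> exists f : {lmorphism C -> target t.1},
    forall c, idx (f c) = pval t.2 (idx (h c)).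
  move=> tF; apply: phomP => [|c]; first exact: (allP Fhom _ tF).
  exact: (allP (hF c) _ tF).
pose I := {t | t \in F}.
pose f (i : I) := sval (cid (hom_of _ (svalP i))).
have fE (i : I) c : idx (f i c) = pval (sval i).2 (idx (h c)).
  exact: (svalP (cid (hom_of _ (svalP i)))).
apply: (@var_of_family N5M C Q I _ f p) => //.
  by move=> i; apply: target_N5M.
move=> x y xy; case: (hp x y) => // /hasP[t tF].
have := congr1 (@idx _) (xy (exist _ t tF)); rewrite !fE /= => ->.
by rewrite eqxx.
Qed.
End Family.

Fixpoint bitseqs n : seq bitseq :=
  if n is n'.+1 then
    let B := bitseqs n' in map (cons true) B ++ map (cons false) B
  else [:: [::]].
Lemma mem_bitseqs n (s : bitseq) : size s = n -> s \in bitseqs n.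
Proof.
elim: n s => [|n IH] [|b s] //= [sn]; rewrite mem_cat.
by case: b; rewrite map_f ?IH ?orbT.
Qed.

Definition closed_bits n (mi ji : nat -> nat -> nat) (s : bitseq) :=
  let S := nth false s in
  all_lt n (fun x => S x ==>
    all_lt n (fun y => S y ==> S (mi x y) && S (ji x y))).

(** The certificate consists of a critical pair [uv], of homomorphisms [F0]
    defined on all of [D] whose common kernel is contained in the congruence
    generated by [uv], and of families [Fs] of partial homomorphisms, each
    family separating the points of its domain, such that every proper
    sublattice is contained in the domain of some family.  The list [E]
    contains the covering pairs of [D] that [F0] identifies; they suffice to
    describe the common kernel of [F0], since two elements are identified as
    soon as their meet and join are linked by a chain of such covers. *)
Definition check (D : diagram) uv (F0 : seq pmap) (Fs : seq (seq pmap)) :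
    bool :=
  let n := dsize D in let mi := tabI D in let ji := tabU D in
  let E := [seq e <- dcov D | ~~ fsep F0 e.1 e.2] in
  [&& critical D uv,
      all (phom_ok n mi ji) F0,
      all_lt n (fdom F0),
      all (fun e => forced n mi ji e.1 e.2 rounds uv.1 uv.2) E,
      all_lt n (fun x => all_lt n (fun y =>
        fsep F0 x y || up_path E n (mi x y) (ji x y))),
      all (fun F => all (phom_ok n mi ji) F &&
        all_lt n (fun x => all_lt n (fun y =>
          [&& fdom F x, fdom F y & x != y] ==> fsep F x y))) Fs
    & all (fun s => closed_bits n mi ji s ==> all id s ||
        has (fun F => all_lt n (fun x => nth false s x ==> fdom F x)) Fs)
        (bitseqs n)].

Lemma path_collapse (D : diagram) (E : seq (nat * nat)) (Q : lattice)
    (f : {lmorphism D -> Q}) k :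
  (forall e, e \in E ->
     exists a b : D, [/\ idx a = e.1, idx b = e.2 & f a = f b]) ->
  forall x y : D, up_path E k (idx x) (idx y) -> f x = f y.
Proof.
move=> hE; elim: k => [|k IH] x y /=.
  by rewrite orbF => /eqP/idx_inj ->.
case/orP=> [/eqP/idx_inj -> //|/hasP[e eE /andP[/eqP ex]]].
have [a [b [ae be ab]]] := hE e eE.
by rewrite -be => /IH <-; rewrite -ab; congr (f _); apply: idx_inj; rewrite ae.
Qed.

Lemma dcov_lt (D : diagram) e :
  e \in dcov D -> (e.1 < dsize D)%N && (e.2 < dsize D)%N.
Proof. by move=> eE; have /and5P[/allP/(_ _ eE)] := diagramP D. Qed.

(** A subquotient of [D] comes from a sublattice [s].  If [s] is proper, one of
    the families in [Fs] puts the subquotient in [N5M].  Otherwise it is a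
    quotient of [D] itself: either an isomorphic copy, or a quotient
    identifying the critical pair, which the maps [F0] put in [N5M]. *)
Theorem HS_diagram (D : diagram) uv F0 Fs (Q : lattice) :
  check D uv F0 Fs -> HS_of D Q ->
  (exists f : {lmorphism D -> Q}, injective f /\ surj f) \/ N5M Q.
Proof.
case/and5P=> crit F0hom F0dom Eforced /and3P[F0sep Fsok subs].
case=> C [h [p [ps hp]]].
pose n := dsize D.
pose s := mkseq (fun k => `[< exists c, idx (h c) = k >]) n.
have sP c : nth false s (idx (h c)).
  by rewrite nth_mkseq ?idx_lt //; apply/asboolP; exists c.
have sPi k : nth false s k -> exists c, idx (h c) = k.
  have [kn|nk] := ltnP k n; first by rewrite nth_mkseq // => /asboolP.
  by rewrite nth_default // size_mkseq.
have s_closed : closed_bits n (tabI D) (tabU D) s.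
  apply/all_ltP => x xn; apply/implyP => /sPi[c <-].
  apply/all_ltP => y yn; apply/implyP => /sPi[c' <-].
  by rewrite tabIE tabUE -homI -homU !sP.
have := allP subs _ (mem_bitseqs (size_mkseq _ _) : s \in bitseqs n).
rewrite s_closed /= => /orP[s_all|/hasP[F FFs sF]]; last first.
  right; have /andP[Fhom Fsep] := allP Fsok F FFs.
  have hF c : fdom F (idx (h c)).
    by move/all_idx: sF => /(_ (h c)) /implyP; apply.
  apply: (family_N5M Fhom ps hF) => c c'.
  have [/hp -> | cc] := pselect (h c = h c'); first by right.
  left; move/all_idx: Fsep => /(_ (h c))/all_idx/(_ (h c')).
  by rewrite !hF /= => /implyP; apply; apply/eqP => /idx_inj.
have hs : surj h.
  move=> x; have [|c hc] := sPi (idx x); last by exists c; apply: idx_inj.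
  by apply: (allP s_all); rewrite mem_nth // size_mkseq idx_lt.
have [f fE] := factor hs hp.
have fs : surj f by move=> q; have [c <-] := ps q; exists (h c).
have [u [v [ue ve uv' fcrit]]] := criticalP crit.
have [fuv|/fcrit fi] := pselect (f u = f v); last by left; exists f.
right; apply: (@family_N5M D F0 F0hom D Q (hom_id D) f fs).
  by move=> x; move/all_idx: F0dom; apply.
move=> x y; move/all_idx: F0sep => /(_ x)/all_idx/(_ y)/orP[|path].
  by left.
right; suff E : f (x `&` y) = f (x `|` y).
  apply: le_anti; apply/andP; split.
    by rewrite -(joinKI (f y) (f x)) -homU -E homI meetA meetxx leIr.
  by rewrite -(joinKI (f x) (f y)) -homU joinC -E homI meetC -meetA meetxx leIl.
move: path; rewrite tabIE tabUE; apply: path_collapse => e eE.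
have := eE; rewrite mem_filter => /andP[_ /dcov_lt/andP[e1 e2]].
exists (elt e1), (elt e2); split=> //.
apply: (forcedP (k := rounds) (x := u) (y := v)) => //.
by have := allP Eforced e eE; rewrite ue ve.
Qed.

(** * The pentagon in nonmodular lattices *)

(** A failure of the modular law at [x], [y], [z] yields the pentagon
    [o < a < b < i], [o < y < i]. *)
Section Pentagon.
Variables (A : lattice) (x y z : A).
Hypothesis xz : x <= z.
Hypothesis nmod : x `|` (y `&` z) <> (x `|` y) `&` z.

Let o := y `&` z.
Let a := x `|` (y `&` z).
Let b := (x `|` y) `&` z.
Let i := x `|` y.
Let pent (k : N5) : A := nth o [:: o; a; b; y; i] (idx k).

Lemma pentagon_hom : exists f : {lmorphism N5 -> A}, injective f.
Proof.
have oa : o <= a by apply: leUr.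
have oy : o <= y by apply: leIl.
have bi : b <= i by apply: leIl.
have yi : y <= i by apply: leUr.
have ab : a <= b.
  by rewrite leUx lexI leUl xz lexI (le_trans oy yi) leIr.
have ob := le_trans oa ab; have ai := le_trans ab bi; have oi := le_trans ob bi.
have bIy : b `&` y = o by rewrite /b /o meetAC joinIK.
have aIy : a `&` y = o.
  by apply: le_anti; rewrite -{1}bIy leI2 //= lexI oa oy.
have aUy : a `|` y = i by rewrite /a /i -joinA (joinC _ y) meetKU.
have bUy : b `|` y = i.
  by apply: le_anti; rewrite leUx bi yi /= -aUy leU2.
have yIb : y `&` b = o by rewrite meetC.
have yIa : y `&` a = o by rewrite meetC.
have yUa : y `|` a = i by rewrite joinC.
have yUb : y `|` b = i by rewrite joinC.
have pI : forall k l, pent (k `&` l) = pent k `&` pent l.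
  case=> [[|[|[|[|[|//]]]]] kP] [[|[|[|[|[|//]]]]] lP];
  rewrite /pent -tabIE /=; rewrite ?meetxx //;
  by first [symmetry; exact: meet_l | symmetry; exact: meet_r].
have pU : forall k l, pent (k `|` l) = pent k `|` pent l.
  case=> [[|[|[|[|[|//]]]]] kP] [[|[|[|[|[|//]]]]] lP];
  rewrite /pent -tabUE /=; rewrite ?joinxx //;
  by first [symmetry; exact: join_l | symmetry; exact: join_r].
exists (mkhom pI pU).
(* The map is injective because it separates a and b, and every congruence of
   the pentagon other than equality identifies these two. *)
have /criticalP[u [v [/= ue ve _ crit]]] : critical N5 (1, 2).
  exact: (erefl true).
by apply: (crit A (mkhom pI pU)); rewrite !mkhomE /pent ue ve /=.
Qed.
End Pentagon.

Lemma nonmodular_N5 (Y : variety) : ~ var_le Y M_var -> var_le N5_var Y.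
Proof.
move=> nY; apply: HSP1_le; apply: contrapT => nN5; apply: nY => A YA x y z xz.
apply: contrapT => nmod; have [f fi] := pentagon_hom xz nmod.
exact/nN5/(var_sub fi).
Qed.

Lemma N5_nonmodular : ~ modular N5.
Proof. by move/modular_diagramP; vm_compute. Qed.

(** * Certificates for the thirteen explicit lattices *)

(** Partial maps on a dual lattice, obtained by composing with the
    antiautomorphisms of the diamond and of the pentagon. *)
Definition dual_pmap (t : pmap) : pmap :=
  let anti := if t.1 then [:: 4; 1; 2; 3; 0] else [:: 4; 2; 1; 3; 0] in
  (t.1, [seq nth undef anti x | x <- t.2]).
Definition dual_family := map dual_pmap.
Definition to_N5 (s : seq nat) : pmap := (false, s).
Definition to_M3 (s : seq nat) : pmap := (true, s).

(** In the tables, the entry at position [k] is the image of the element [k].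
    The domains of the families in [L1_proper] and its analogues are the
    maximal proper sublattices. *)
Definition L1_full := [:: to_N5 [:: 0; 1; 0; 3; 1; 3; 4]].
Definition L1_proper := [::
  [:: to_N5 [:: 0; 1; 9; 3; 2; 9; 4]];
  [:: to_N5 [:: 0; 3; 9; 1; 9; 2; 4]];
  [:: to_N5 [:: 0; 1; 0; 9; 1; 3; 4]; to_N5 [:: 0; 0; 1; 9; 1; 1; 1]];
  [:: to_N5 [:: 0; 9; 0; 1; 3; 1; 4]; to_N5 [:: 0; 9; 1; 0; 1; 1; 1]]].
Definition L3_full := [:: to_N5 [:: 0; 1; 1; 1; 0; 2; 2]].
Definition L3_proper := [::
  [:: to_N5 [:: 0; 1; 2; 4; 3; 9; 4]; to_N5 [:: 0; 0; 0; 0; 0; 9; 1]];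
  [:: to_N5 [:: 0; 0; 1; 2; 9; 3; 4]; to_N5 [:: 0; 1; 1; 1; 9; 1; 1]];
  [:: to_N5 [:: 0; 0; 9; 1; 1; 3; 4]; to_N5 [:: 0; 1; 9; 1; 0; 1; 1]]].
Definition L4_full := [:: to_N5 [:: 0; 0; 0; 1; 0; 1]].
Definition L4_proper := [::
  [:: to_N5 [:: 0; 1; 3; 9; 4; 4]; to_N5 [:: 0; 0; 0; 9; 0; 1]];
  [:: to_N5 [:: 0; 1; 9; 3; 2; 4]];
  [:: to_N5 [:: 0; 9; 1; 3; 2; 4]]].
Definition V6_full := [:: to_N5 [:: 0; 0; 1; 3; 3; 3; 3; 3; 4]].
Definition V6_proper := [::
  [:: to_N5 [:: 0; 0; 3; 1; 1; 2; 9; 2; 4];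
      to_N5 [:: 0; 1; 1; 0; 1; 0; 9; 1; 1]];
  [:: to_N5 [:: 0; 0; 3; 1; 1; 9; 2; 2; 4];
      to_N5 [:: 0; 1; 1; 0; 1; 9; 0; 1; 1]];
  [:: to_M3 [:: 0; 1; 9; 0; 1; 2; 3; 4; 4];
      to_N5 [:: 0; 0; 9; 1; 1; 1; 1; 1; 2]]].
Definition W1_full := [:: to_M3 [:: 0; 1; 1; 2; 3; 4]].
Definition W1_proper := [::
  [:: to_N5 [:: 0; 1; 2; 3; 9; 4]];
  [:: to_N5 [:: 0; 1; 2; 9; 3; 4]];
  [:: to_M3 [:: 0; 1; 9; 2; 3; 4]];
  [:: to_M3 [:: 0; 9; 1; 2; 3; 4]]].
Definition W2_full := [:: to_N5 [:: 0; 1; 3; 3; 3; 3; 3; 4]].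
Definition W2_proper := [::
  [:: to_N5 [:: 0; 3; 1; 1; 2; 9; 2; 4]; to_N5 [:: 0; 3; 1; 2; 1; 9; 2; 4]];
  [:: to_N5 [:: 0; 3; 1; 1; 9; 2; 2; 4]; to_N5 [:: 0; 3; 1; 2; 9; 1; 2; 4]];
  [:: to_N5 [:: 0; 3; 1; 9; 1; 2; 2; 4]; to_N5 [:: 0; 3; 1; 9; 2; 1; 2; 4]];
  [:: to_M3 [:: 0; 9; 0; 1; 2; 3; 4; 4]; to_N5 [:: 0; 9; 1; 1; 1; 1; 1; 2]]].
Definition W3_full :=
  [:: to_M3 [:: 0; 1; 2; 3; 4; 1; 1; 4];
      to_N5 [:: 0; 0; 0; 0; 0; 1; 1; 1]].
Definition W3_proper := [::
  [:: to_M3 [:: 0; 1; 2; 3; 4; 1; 9; 4]; to_N5 [:: 0; 0; 0; 0; 0; 1; 9; 1]];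
  [:: to_M3 [:: 0; 1; 2; 3; 4; 9; 1; 4]; to_N5 [:: 0; 0; 0; 0; 0; 9; 1; 1]];
  [:: to_N5 [:: 0; 0; 3; 9; 3; 1; 2; 4]; to_N5 [:: 0; 1; 0; 9; 1; 1; 1; 1]];
  [:: to_N5 [:: 0; 0; 9; 3; 3; 1; 2; 4]; to_N5 [:: 0; 1; 9; 0; 1; 1; 1; 1]]].
Definition W5_full :=
  [:: to_M3 [:: 0; 1; 2; 3; 4; 4; 1; 4];
      to_N5 [:: 0; 0; 0; 0; 0; 0; 1; 1]].
Definition W5_proper := [::
  [:: to_M3 [:: 0; 1; 2; 3; 4; 4; 9; 4]; to_N5 [:: 0; 0; 0; 0; 0; 1; 9; 2]];
  [:: to_M3 [:: 0; 1; 2; 3; 4; 9; 1; 4]; to_N5 [:: 0; 0; 0; 0; 0; 9; 1; 1]];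
  [:: to_N5 [:: 0; 0; 1; 9; 1; 2; 3; 4]; to_N5 [:: 0; 1; 0; 9; 1; 1; 1; 1]];
  [:: to_N5 [:: 0; 0; 9; 1; 1; 2; 3; 4]; to_N5 [:: 0; 1; 9; 0; 1; 1; 1; 1]]].

(* These equalities are left to kernel conversion, which is lazy: the searches
   for paths in a diagram then stop at the first success, whereas an eager
   evaluator would explore all paths. *)
Lemma L1_check :
  check L1 (0, 2) L1_full L1_proper.
Proof. exact: (erefl true). Qed.
Lemma L2_check :
  check L2 (0, 2) (dual_family L1_full) (map dual_family L1_proper).
Proof. exact: (erefl true). Qed.
Lemma L3_check :
  check L3 (0, 4) L3_full L3_proper.
Proof. exact: (erefl true). Qed.
Lemma L4_check :
  check L4 (0, 1) L4_full L4_proper.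
Proof. exact: (erefl true). Qed.
Lemma L5_check :
  check L5 (0, 1) (dual_family L4_full) (map dual_family L4_proper).
Proof. exact: (erefl true). Qed.
Lemma V6_check :
  check V6 (3, 5) V6_full V6_proper.
Proof. exact: (erefl true). Qed.
Lemma V7_check :
  check V7 (3, 5) (dual_family V6_full) (map dual_family V6_proper).
Proof. exact: (erefl true). Qed.
Lemma W1_check :
  check W1 (1, 2) W1_full W1_proper.
Proof. exact: (erefl true). Qed.
Lemma W2_check :
  check W2 (2, 3) W2_full W2_proper.
Proof. exact: (erefl true). Qed.
Lemma W3_check :
  check W3 (5, 6) W3_full W3_proper.
Proof. exact: (erefl true). Qed.
Lemma W4_check :
  check W4 (5, 6) (dual_family W3_full) (map dual_family W3_proper).
Proof. exact: (erefl true). Qed.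
Lemma W5_check :
  check W5 (4, 5) W5_full W5_proper.
Proof. exact: (erefl true). Qed.
Lemma W6_check :
  check W6 (4, 5) (dual_family W5_full) (map dual_family W5_proper).
Proof. exact: (erefl true). Qed.

(** * Covers of the join of N5 and the modular variety *)

Lemma N5M_N5 : var_le N5_var N5M. Proof. exact: var_le_joinl. Qed.
Lemma N5M_M : var_le M_var N5M. Proof. exact: var_le_joinr. Qed.

(** Subdirectly irreducible lattices have this property by [in_var_join]. *)
Definition join_prime (L : lattice) : Prop :=
  forall V W : variety, var_join V W L -> V L \/ W L.

(** What remains of the covering of N5 by HSP(L) when modular lattices are
    disregarded.  In this form it also holds for the lattices [V_j], whose
    varieties contain M3 and do not cover N5. *)
Definition atomic (L : lattice) : Prop :=
  forall Y : variety, var_le Y (HSP1 L) -> Y L \/ var_le Y N5M.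

Section Cover.
Variable L : lattice.
Hypotheses (nL : ~ N5M L) (pL : join_prime L) (aL : atomic L).

Lemma N5_le_HSP1 : var_le N5_var (HSP1 L).
Proof.
by apply: nonmodular_N5 => /(_ L (@in_HSP1 L)) /N5M_M.
Qed.

Lemma N5M_le_with_M : var_le N5M (with_M (HSP1 L)).
Proof.
apply: var_join_le; last exact: var_le_joinr.
exact: var_le_trans N5_le_HSP1 (@var_le_joinl _ _).
Qed.

(** For [Z] between [N5M] and [with_M (HSP1 L)], distributivity makes [Z] the
    join of its intersections with HSP(L) and with M.  By [atomic], the first
    of these contains [L] or is below [N5M]. *)
Lemma with_M_covers : var_covers N5M (with_M (HSP1 L)).
Proof.
split; first split; first exact: N5M_le_with_M.
  move=> E; apply: nL; rewrite E.
  by apply: var_le_joinl; apply: in_HSP1.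
case=> Z [[NZ neNZ] [ZX neZX]].
have [|[ZL _]|ZN] := aL (Y := var_meet Z (HSP1 L)).
- by move=> A [].
- apply: neZX; apply: var_le_anti => //; apply: var_join_le.
    exact: HSP1_le.
  exact: var_le_trans N5M_M NZ.
- apply: neNZ; apply: var_le_anti => // A ZA.
  have : var_meet Z (with_M (HSP1 L)) A by split; [|apply: ZX].
  move/var_meet_join_distr; move: A {ZA}; apply: var_join_le => // A [_].
  exact: N5M_M.
Qed.

Lemma in_with_M (V : variety) : with_M V L -> V L.
Proof. by case/pL => // /N5M_M. Qed.
End Cover.

Lemma with_M_inj (L L' : lattice) :
  ~ N5M L -> join_prime L -> ~ N5M L' -> join_prime L' ->
  with_M (HSP1 L) = with_M (HSP1 L') -> HSP1 L = HSP1 L'.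
Proof.
move=> nL pL nL' pL' E; apply: var_le_anti; apply: HSP1_le.
  by apply: (in_with_M nL pL); rewrite -E; apply: var_le_joinl; apply: in_HSP1.
by apply: (in_with_M nL' pL'); rewrite E; apply: var_le_joinl; apply: in_HSP1.
Qed.

Section Critical.
Variables (D : diagram) (uv : nat * nat).
Hypothesis crit : critical D uv.

Lemma critical_join_prime : join_prime D.
Proof.
have [u [v [_ _ uv' inj]]] := criticalP crit.
move=> V W /in_var_join[B [C [f [g [_ _ VB WC fg]]]]].
have [fuv|/inj fi] := pselect (f u = f v); last by left; exact: (var_sub fi VB).
right; apply: (@var_sub W _ _ g) => //; apply: inj => guv.
exact/uv'/fg.
Qed.

Lemma critical_HSP1 (L : lattice) : finite_lattice L -> HSP1 L D ->
  exists (Q : lattice) (r : {lmorphism D -> Q}),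
    [/\ HS_of L Q, surj r & injective r].
Proof.
have [u [v [_ _ uv' inj]]] := criticalP crit.
by move=> Lf /(jonsson Lf) /(_ uv')[Q [r [LQ rs /inj ri]]]; exists Q, r.
Qed.
End Critical.

(** Choosing preimages turns an embedding into a subquotient of [T] into an
    injection [g] of sets into [T], which bounds the size of [D]. *)
Lemma HS_section (D T : diagram) (Q : lattice) (r : {lmorphism D -> Q}) :
  injective r -> HS_of T Q -> exists g : D -> T, injective g /\
    exists (C : lattice) (h : {lmorphism C -> T}) (p : {lmorphism C -> Q})
      (s : D -> C), [/\ surj p, forall x y, h x = h y -> p x = p y,
       forall x, p (s x) = r x & g = h \o s].
Proof.
move=> ri [C [h [p [ps hp]]]].
have [s sE] := choice (fun x => ps (r x)).
exists (h \o s); split; last by exists C, h, p, s.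
by move=> x y /hp; rewrite !sE => /ri.
Qed.

Lemma leq_diagram (D T : diagram) (g : D -> T) :
  injective g -> (dsize D <= dsize T)%N.
Proof.
move=> gi; rewrite -[dsize D]card_ord -[dsize T]card_ord.
exact: (@leq_card 'I_(dsize D) 'I_(dsize T) g gi).
Qed.

Lemma surj_diagram (D T : diagram) (g : D -> T) :
  injective g -> dsize D = dsize T -> forall t, exists x, g x = t.
Proof.
move=> gi DT t.
have [//|h hK hK'] := @inj_card_bij 'I_(dsize D) 'I_(dsize T) g gi _.
  by rewrite !card_ord DT.
by exists (h t).
Qed.

Lemma M3_critical : critical M3 (0, 1). Proof. exact: (erefl true). Qed.

(** Otherwise M3 would embed in a subquotient of the pentagon; both have five
    elements, so this subquotient would be the pentagon itself and also a
    quotient of M3, hence modular. *)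
Lemma M3_notin_N5 : ~ N5_var M3.
Proof.
case/(critical_HSP1 M3_critical (diagram_finite N5)) => Q [r [N5Q rs ri]].
have [g [gi [C [h [p [s [ps hp sE gE]]]]]]] := HS_section ri N5Q.
have gs : forall t, exists x, g x = t.
  exact: (@surj_diagram M3 N5 g gi (erefl 5)).
have hs : surj h by move=> t; have [x <-] := gs t; exists (s x); rewrite gE.
have [f fE] := factor hs hp.
apply: N5_nonmodular; apply: (@var_sub M_var _ _ f).
  move=> t t'; have [x <-] := gs t; have [y <-] := gs t'.
  by rewrite gE /= !fE !sE => /ri ->.
exact: (@var_img M_var _ _ r rs M3_modular).
Qed.

(** A lattice with a critical pair that lies in the join is modular or lies in
    the variety of the pentagon; in the latter case it embeds in a subquotient
    of the pentagon and has at most five elements. *)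
Lemma critical_notin_N5M (D : diagram) uv : critical D uv ->
  ~~ modular_diagram D -> (5 < dsize D)%N -> ~ N5M D.
Proof.
move=> crit /negP nmod D5 /(critical_join_prime crit)[|/modular_diagramP//].
case/(critical_HSP1 crit (diagram_finite N5)) => Q [r [N5Q _ ri]].
have [g [gi _]] := HS_section ri N5Q.
by move: D5; rewrite ltnNge => /negP; apply; apply: leq_diagram gi.
Qed.

Section Checked.
Variables (D : diagram) (uv : nat * nat) (F0 : seq pmap) (Fs : seq (seq pmap)).
Hypothesis Dok : check D uv F0 Fs.

Lemma check_critical : critical D uv.
Proof. by case/andP: Dok. Qed.

(** Every member of a subvariety that avoids [D] is separated by quotients in
    HS(D), none of which contains a copy of [D]; so [HS_diagram] puts all of
    them in [N5M]. *)
Lemma check_atomic : atomic D.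
Proof.
move=> Y YD; have [DY|nDY] := pselect (Y D); [by left | right] => A YA.
apply: (@var_of_separating N5M) => x y xy.
have [Q [r [DQ rs rxy]]] := jonsson (diagram_finite D) (YD A YA) xy.
exists Q, r; split=> //; have [[f [fi _]]|//] := HS_diagram Dok DQ.
by case: nDY; apply: var_sub fi (var_img rs YA).
Qed.

Lemma check_embed (D' : diagram) uv' : critical D' uv' -> ~ N5M D' ->
  HSP1 D D' -> exists f : {lmorphism D' -> D}, injective f.
Proof.
move=> crit' nD' /(critical_HSP1 crit' (diagram_finite D))[Q [r [DQ _ ri]]].
have [[f [fi fs]]|NQ] := HS_diagram Dok DQ; last first.
  by case: nD'; apply: var_sub ri NQ.
have ker_id x y : f x = f y -> hom_id D x = hom_id D y by move/fi.
have [g gE] := factor fs ker_id.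
exists (hom_comp g r) => x y; rewrite !hom_compE.
have [a ax] := fs (r x); have [b bx] := fs (r y).
by rewrite -ax -bx !gE /= => ab; apply: ri; rewrite -ax -bx; congr (f _).
Qed.
End Checked.

(** A numerical invariant of finite lattices.  Squaring only the sizes of the
    principal ideals, and not those of the principal filters, makes it tell
    dual lattices apart. *)
Definition shape (D : diagram) : nat :=
  let n := dsize D in let mi := tabI D in
  sumn [seq count (fun y => mi y x == y) (iota 0 n) ^ 2 *
            count (fun y => mi x y == x) (iota 0 n) | x <- iota 0 n]%N.

Lemma sum_iota n (F : nat -> nat) :
  sumn [seq F x | x <- iota 0 n] = (\sum_(x < n) F x)%N.
Proof. by rewrite sumnE big_map -{1}[n]subn0 big_mkord. Qed.

Lemma count_iota n (P : pred nat) :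
  count P (iota 0 n) = (\sum_(x < n | P x) 1)%N.
Proof. by rewrite -sum1_count -{1}[n]subn0 big_mkord. Qed.

Lemma shapeE (D : diagram) : shape D =
  (\sum_(x < dsize D) (\sum_(y < dsize D | ((y : D) <= (x : D))%O) 1) ^ 2 *
                      \sum_(y < dsize D | ((x : D) <= (y : D))%O) 1)%N.
Proof.
have le_tab (x y : D) : (tabI D (idx x) (idx y) == idx x) = (x <= y).
  by rewrite tabIE leEmeet; apply/eqP/eqP => [/idx_inj|->].
rewrite /shape sum_iota; apply: eq_bigr => x _; rewrite !count_iota.
by congr (_ ^ 2 * _)%N; apply: eq_bigl => y; apply: le_tab.
Qed.

Lemma shape_iso (D T : diagram) (f : {lmorphism D -> T}) :
  injective f -> dsize D = dsize T -> shape D = shape T.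
Proof.
move=> fi DT; pose g : 'I_(dsize D) -> 'I_(dsize T) := f.
have gb : bijective g by apply: (inj_card_bij fi); rewrite !card_ord DT.
have f_le (x y : D) : (f x <= f y) = (x <= y).
  by rewrite !leEmeet -homI; apply/eqP/eqP => [/fi|->].
rewrite !shapeE [RHS](reindex g) /=; last exact: onW_bij.
apply: eq_bigr => x _; congr (_ ^ 2 * _)%N.
  rewrite [RHS](reindex g) /=; last exact: onW_bij.
  by apply: eq_bigl => y; rewrite -[LHS]f_le.
rewrite [RHS](reindex g) /=; last exact: onW_bij.
by apply: eq_bigl => y; rewrite -[LHS]f_le.
Qed.

Lemma shape_of_embeddings (D T : diagram) (f : {lmorphism D -> T})
    (g : {lmorphism T -> D}) : injective f -> injective g -> shape D = shape T.
Proof.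
move=> fi gi; apply: (shape_iso fi); apply/eqP.
by rewrite eqn_leq (leq_diagram fi) (leq_diagram gi).
Qed.

(** * Covers of an element of a distributive lattice *)

(** Each [X k] is an atom of the interval above [O]: any [Z] above [O] either
    contains [X k] or meets it in [O]. *)
Section Boolean.
Variables (O : variety) (n : nat) (X : 'I_n -> variety).
Hypothesis n2 : (1 < n)%N.
Hypothesis Xcov : forall k, var_covers O (X k).
Hypothesis Xinj : injective X.

Let OX k : var_le O (X k). Proof. by have [[]] := Xcov k. Qed.
Let neOX k : O <> X k. Proof. by have [[]] := Xcov k. Qed.
Let between k Z : var_le O Z -> var_le Z (X k) -> Z = O \/ Z = X k.
Proof.
move=> OZ ZX; have [_ cov] := Xcov k.
have [->|nO] := pselect (Z = O); first by left.
have [->|nX] := pselect (Z = X k); first by right.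
by case: cov; exists Z; split; split=> // E; apply: nO.
Qed.

Lemma var_meet_lel V W : var_le (var_meet V W) V. Proof. by move=> A []. Qed.
Lemma var_meet_ler V W : var_le (var_meet V W) W. Proof. by move=> A []. Qed.
Lemma var_le_meet U V W : var_le U V -> var_le U W -> var_le U (var_meet V W).
Proof. by move=> UV UW A UA; split; [apply: UV | apply: UW]. Qed.

Definition joins (s : seq 'I_n) : variety :=
  foldr (fun k => var_join (X k)) O s.

Lemma joins_O s : var_le O (joins s).
Proof.
by elim: s => //= k s IH; apply: var_le_trans IH (@var_le_joinr _ _).
Qed.

Lemma joins_X s k : k \in s -> var_le (X k) (joins s).
Proof.
elim: s => //= l s IH; rewrite inE => /orP[/eqP->|/IH h].
  exact: var_le_joinl.
exact: var_le_trans h (@var_le_joinr _ _).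
Qed.

Lemma joins_le s Z : var_le O Z -> (forall k, k \in s -> var_le (X k) Z) ->
  var_le (joins s) Z.
Proof.
move=> OZ; elim: s => //= k s IH h; apply: var_join_le.
  by apply: h; rewrite mem_head.
by apply: IH => l ls; apply: h; rewrite inE ls orbT.
Qed.

(** By distributivity, [Z] is the join of its meets with the [X k]; each of
    these is [O] or [X k], and in the second case [X k] is below [Y]. *)
Lemma below_joins s Y Z : var_le O Z -> var_le Z Y -> var_le Z (joins s) ->
  var_le Z (joins [seq k <- s | `[< var_le (X k) Y >]]).
Proof.
move=> OZ ZY; elim: s Z OZ ZY => //= k s IH Z OZ ZY Zs.
set J := (X in var_le Z X).
have ZJ : var_le (var_meet Z (X k)) J.
  have OZX : var_le O (var_meet Z (X k)) by apply: var_le_meet.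
  have [->|E] := between OZX (@var_meet_ler _ _); first exact: joins_O.
  rewrite E /J; have -> : `[< var_le (X k) Y >].
    by apply/asboolP; rewrite -E; apply: var_le_trans ZY; apply: var_meet_lel.
  exact: var_le_joinl.
have ZJ' : var_le (var_meet Z (joins s)) J.
  apply: (@var_le_trans _ (joins [seq k <- s | `[< var_le (X k) Y >]])).
    apply: IH; last exact: var_meet_ler.
      by apply: var_le_meet => //; apply: joins_O.
    exact: var_le_trans (@var_meet_lel _ _) ZY.
  rewrite /J; case: ifP => _ //=; exact: var_le_joinr.
move=> A ZA; have : var_meet Z (var_join (X k) (joins s)) A.
  by split; [exact: ZA | exact: (Zs A ZA)].
by move/var_meet_join_distr/(var_join_le ZJ ZJ').
Qed.

Lemma X_joins s k : var_le (X k) (joins s) -> k \in s.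
Proof.
move=> ks; have := below_joins (OX k) (@var_le_refl _) ks.
case Fs: [seq l <- s | _] => [|l t] kF.
  by case: (@neOX k); apply: var_le_anti.
have : l \in [seq l <- s | `[< var_le (X l) (X k) >]] by rewrite Fs mem_head.
rewrite mem_filter => /andP[/asboolP lk ls].
have [E|/Xinj <- //] := between (OX l) lk.
by case: (@neOX l).
Qed.

Definition jset (A : {set 'I_n}) : variety := joins (enum A).

Lemma X_jset (A : {set 'I_n}) k : var_le (X k) (jset A) <-> k \in A.
Proof.
by split=> [/X_joins|kA]; [rewrite mem_enum | apply: joins_X; rewrite mem_enum].
Qed.

Lemma jset_le (A : {set 'I_n}) Z : var_le O Z ->
  (forall k, k \in A -> var_le (X k) Z) -> var_le (jset A) Z.
Proof. by move=> OZ AZ; apply: joins_le => // k; rewrite mem_enum => /AZ. Qed.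

(** Every variety in the interval is the join of the atoms below it. *)
Lemma jset_of Y : var_le O Y -> var_le Y (jset [set: 'I_n]) ->
  jset [set k | `[< var_le (X k) Y >]] = Y.
Proof.
move=> OY YT; apply: var_le_anti.
  by apply: jset_le => // k; rewrite inE => /asboolP.
apply: var_le_trans (below_joins OY (@var_le_refl _) YT) _.
apply: joins_le => [|k]; first exact: joins_O.
by rewrite mem_filter => /andP[kY _]; apply/X_jset; rewrite inE.
Qed.

Lemma jset_O A : var_le O (jset A). Proof. exact: joins_O. Qed.
Lemma jset_T A : var_le (jset A) (jset [set: 'I_n]).
Proof.
by apply: jset_le => [|k _]; [apply: jset_O | apply/X_jset; rewrite inE].
Qed.

Lemma jset_inj : injective jset.
Proof.
move=> A B AB; apply/setP => k.
by apply/idP/idP => kA; apply/X_jset; [rewrite -AB|rewrite AB]; apply/X_jset.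
Qed.

Lemma jsetU A B : jset (A :|: B) = var_join (jset A) (jset B).
Proof.
apply: var_le_anti.
  apply: jset_le => [|k].
    exact: var_le_trans (@jset_O A) (@var_le_joinl _ _).
  rewrite inE => /orP[] /X_jset h; apply: var_le_trans h _.
    exact: var_le_joinl.
  exact: var_le_joinr.
by apply: var_join_le; apply: jset_le => [|k kA];
  first [exact: jset_O | apply/X_jset; rewrite inE kA ?orbT].
Qed.

Lemma jsetI A B : jset (A :&: B) = var_meet (jset A) (jset B).
Proof.
have OAB : var_le O (var_meet (jset A) (jset B)).
  by apply: var_le_meet; apply: jset_O.
have ABT : var_le (var_meet (jset A) (jset B)) (jset [set: 'I_n]).
  exact: var_le_trans (@var_meet_lel _ _) (@jset_T A).
rewrite -(jset_of OAB ABT); congr jset; apply/setP => k; rewrite !inE.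
apply/andP/asboolP => [[/X_jset kA /X_jset kB]|kAB]; first exact: var_le_meet.
split; apply/X_jset; apply: var_le_trans kAB _.
  exact: var_meet_lel.
exact: var_meet_ler.
Qed.

Section Generated.
Variable G : variety -> Prop.
Hypothesis GX : forall Y, G Y <-> exists k, X k = Y.

(** The bottom [O] is reached as the meet of two different generators, which is
    why [n] must be at least 2. *)
Lemma generatedP Y :
  generated_sublattice G Y <-> var_le O Y /\ var_le Y (jset [set: 'I_n]).
Proof.
split=> [|[OY YT] S Slat GS].
  move/(_ (fun Z => var_le O Z /\ var_le Z (jset [set: 'I_n]))).
  apply=> [V W [OV VT] [OW WT]|V /GX[k <-]]; last first.
    by split; [exact: OX | apply/X_jset; rewrite inE].
  split; split.
  - exact: var_le_trans OV (@var_le_joinl _ _).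
  - exact: var_join_le.
  - exact: var_le_meet.
  - exact: var_le_trans (@var_meet_lel _ _) VT.
have SX k : S (X k) by apply: GS; apply/GX; exists k.
pose k0 := Ordinal (ltnW n2); pose k1 := Ordinal n2.
have SO : S O.
  have [_] := Slat _ _ (SX k0) (SX k1).
  have OZ : var_le O (var_meet (X k0) (X k1)) by apply: var_le_meet.
  have [->//|E] := between OZ (@var_meet_lel _ _).
  have X01 : var_le (X k0) (X k1) by rewrite -E; apply: var_meet_ler.
  have [E'|/Xinj//] := between (OX k0) X01.
  by case: (@neOX k0).
rewrite -(jset_of OY YT) /jset; elim: (enum _) => //= k s IH.
by have [] := Slat _ _ (SX k) IH.
Qed.

Lemma boolean_interval :
  [/\ has_n_elements n G, isomorphic_to_Boolean n (generated_sublattice G)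
    & is_interval (generated_sublattice G)].
Proof.
split; first by exists X; split.
  exists jset; split; [exact: jset_inj | | exact: jsetU | exact: jsetI].
  move=> Y; rewrite generatedP; split=> [[OY YT]|[A <-]].
    by exists [set k | `[< var_le (X k) Y >]]; apply: jset_of.
  by split; [apply: jset_O | apply: jset_T].
exists O, (jset [set: 'I_n]); split; first exact: jset_O.
exact: generatedP.
Qed.
End Generated.
End Boolean.

(** * The 23 generators *)

Definition listed_diagrams : seq diagram :=
  [:: L1; L2; L3; L4; L5; W1; W2; W3; W4; W5; V6; V7; W6].
Definition listed (k : nat) : diagram := nth N5 listed_diagrams k.

Definition checked (D : diagram) : Prop := exists uv F0 Fs, check D uv F0 Fs.

Lemma listed_checked k : (k < 13)%N -> checked (listed k).
Proof.
case: k; first by do 3!eexists; apply: L1_check.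
case; first by do 3!eexists; apply: L2_check.
case; first by do 3!eexists; apply: L3_check.
case; first by do 3!eexists; apply: L4_check.
case; first by do 3!eexists; apply: L5_check.
case; first by do 3!eexists; apply: W1_check.
case; first by do 3!eexists; apply: W2_check.
case; first by do 3!eexists; apply: W3_check.
case; first by do 3!eexists; apply: W4_check.
case; first by do 3!eexists; apply: W5_check.
case; first by do 3!eexists; apply: V6_check.
case; first by do 3!eexists; apply: V7_check.
by case=> // _; do 3!eexists; apply: W6_check.
Qed.

Lemma listed_nonmodular_large :
  all (fun D => ~~ modular_diagram D && (5 < dsize D)%N) listed_diagrams.
Proof. exact: (erefl true). Qed.

Lemma listed_shapes_uniq : uniq (map shape listed_diagrams).
Proof. exact: (erefl true). Qed.

Lemma listed_notin k : (k < 13)%N -> ~ N5M (listed k).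
Proof.
move=> k13; have [uv [F0 [Fs /check_critical crit]]] := listed_checked k13.
have /andP[nm sz] : ~~ modular_diagram (listed k) && (5 < dsize (listed k))%N.
  exact: (all_nthP N5 listed_nonmodular_large k k13).
exact: critical_notin_N5M crit nm sz.
Qed.
Lemma listed_prime k : (k < 13)%N -> join_prime (listed k).
Proof.
move=> k13; have [uv [F0 [Fs /check_critical crit]]] := listed_checked k13.
exact: critical_join_prime crit.
Qed.
Lemma listed_atomic k : (k < 13)%N -> atomic (listed k).
Proof.
move=> k13; have [uv [F0 [Fs ok]]] := listed_checked k13.
exact: check_atomic ok.
Qed.
Lemma listed_embed k l :
  (k < 13)%N -> (l < 13)%N -> HSP1 (listed l) (listed k) ->
  exists f : {lmorphism listed k -> listed l}, injective f.
Proof.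
move=> k13 l13; have [uv [F0 [Fs /check_critical crit]]] := listed_checked k13.
have [uv' [F0' [Fs' ok]]] := listed_checked l13.
exact: check_embed ok _ _ crit (listed_notin k13).
Qed.
(** Lattices generating the same variety embed in each other, so they are
    isomorphic, and their shapes agree. *)
Lemma listed_inj k l :
  (k < 13)%N -> (l < 13)%N -> HSP1 (listed k) = HSP1 (listed l) -> k = l.
Proof.
move=> k13 l13 E.
have [f fi] : exists f : {lmorphism listed k -> listed l}, injective f.
  by apply: listed_embed => //; rewrite -E; apply: in_HSP1.
have [g gi] : exists g : {lmorphism listed l -> listed k}, injective g.
  by apply: listed_embed => //; rewrite E; apply: in_HSP1.
have /eqP := shape_of_embeddings fi gi.
rewrite /listed -(nth_map N5 0 shape (k13 : k < size listed_diagrams)%N).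
rewrite -(nth_map N5 0 shape (l13 : l < size listed_diagrams)%N).
by rewrite (nth_uniq 0 _ _ listed_shapes_uniq) ?size_map // => /eqP.
Qed.

Lemma L1_to_5E (i : 'I_5) : L1_to_5 i = listed i.
Proof. by case: i => [[|[|[|[|[|//]]]]]]. Qed.
Lemma V_latticeE (j : 'I_8) : V_lattice j = listed (5 + j).
Proof. by case: j => [[|[|[|[|[|[|[|[|//]]]]]]]]]. Qed.

Lemma M3_in_HSP1 (T : diagram) s :
  [&& phom T 5 (tabI M3) (tabU M3) s, all_lt 5 (fun x => pval s x < dsize T)%N
    & pval s 0 != pval s 1] -> HSP1 T M3.
Proof.
case/and3P=> s_hom s_dom s01.
have [|f fE] := @phomP M3 T s M3 (hom_id M3) s_hom.
  by move=> c; move/(@all_idx M3): s_dom; apply.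
have [u [v [ue ve _ inj]]] := criticalP M3_critical.
apply: (@var_sub (HSP1 T) _ _ f (inj _ f _)); last exact: in_HSP1.
by move/(congr1 (@idx T)); rewrite !fE /= ue ve; apply/eqP.
Qed.

Lemma M3_in_V (j : 'I_8) : HSP1 (V_lattice j) M3.
Proof.
case: j => [[|[|[|[|[|[|[|[|//]]]]]]]] j8].
- by apply: (@M3_in_HSP1 W1 [:: 0; 1; 3; 4; 5]); exact: (erefl true).
- by apply: (@M3_in_HSP1 W2 [:: 2; 3; 4; 5; 6]); exact: (erefl true).
- by apply: (@M3_in_HSP1 W3 [:: 0; 1; 2; 3; 4]); exact: (erefl true).
- by apply: (@M3_in_HSP1 W4 [:: 4; 1; 2; 3; 0]); exact: (erefl true).
- by apply: (@M3_in_HSP1 W5 [:: 0; 1; 2; 3; 4]); exact: (erefl true).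
- by apply: (@M3_in_HSP1 V6 [:: 3; 4; 5; 6; 7]); exact: (erefl true).
- by apply: (@M3_in_HSP1 V7 [:: 7; 4; 5; 6; 3]); exact: (erefl true).
- by apply: (@M3_in_HSP1 W6 [:: 4; 1; 2; 3; 0]); exact: (erefl true).
Qed.

(** A subdirect representation with two factors is indexed by the booleans. *)
Lemma SI_join_prime (L : lattice) : subdirectly_irreducible L -> join_prime L.
Proof.
move=> SI V W /in_var_join[B [C [f [g [fs gs VB WC fg]]]]].
pose E (b : bool) : lattice := if b then B else C.
pose e (b : bool) : {lmorphism L -> E b} :=
  if b as b return {lmorphism L -> E b} then f else g.
have [||[] ei] := SI bool E e.
- by case=> y; [apply: fs | apply: gs].
- by move=> x y xy; apply: fg; [apply: (xy true) | apply: (xy false)].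
- by left; apply: var_sub ei VB.
- by right; apply: var_sub ei WC.
Qed.

(** The join of N5 with a subvariety [Y] of HSP(L) is N5 or HSP(L).  In the
    second case [L] lies in N5 or in [Y] because it is join-prime. *)
Lemma cover_atomic (L : lattice) : var_covers N5_var (HSP1 L) ->
  join_prime L -> atomic L.
Proof.
move=> [[NL neNL] cov] pL Y YL.
pose J := var_join N5_var Y.
have NJ : var_le N5_var J by apply: var_le_joinl.
have JL : var_le J (HSP1 L) by apply: var_join_le.
have YJ : var_le Y J by apply: var_le_joinr.
have [EN|nEN] := pselect (N5_var = J).
  right; apply: var_le_trans YJ _; rewrite -EN; exact: N5M_N5.
have [EL|nEL] := pselect (J = HSP1 L); last by case: cov; exists J.
left; have : J L by rewrite EL; apply: in_HSP1.
case/pL => // NL5; case: neNL; apply: var_le_anti => //.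
exact: HSP1_le.
Qed.

Section Generators.
Variable K : 'I_10 -> lattice.
Hypothesis hK : lists_L6_to_15 K.

Lemma K_covers b : var_covers N5_var (HSP1 (K b)).
Proof.
have [_ _ char] := hK.
by have [|] := (char (HSP1 (K b))).1; first by exists b.
Qed.
Lemma K_prime b : join_prime (K b).
Proof. by have [/(_ b)[_ /SI_join_prime]] := hK. Qed.
Lemma K_atomic b : atomic (K b).
Proof. exact: cover_atomic (K_covers b) (@K_prime b). Qed.
Lemma K_notin b : ~ N5M (K b).
Proof.
have [[NK neNK] _] := K_covers b.
case/(@K_prime b) => [KN|KM].
  by apply: neNK; apply: var_le_anti => //; apply: HSP1_le.
exact: N5_nonmodular (HSP1_le KM (NK _ (@in_HSP1 N5))).
Qed.
(** If the two varieties were equal, the join of N5 with HSP(M3) would lie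
    between N5 and HSP(K b).  It is larger than N5 by [M3_notin_N5], and it
    cannot be HSP(K b), which is not below [N5M]. *)
Lemma K_neq_V b j : HSP1 (K b) <> HSP1 (V_lattice j).
Proof.
move=> E; have M3K : HSP1 (K b) M3 by rewrite E; apply: M3_in_V.
have [[NK neNK] cov] := K_covers b.
pose J := var_join N5_var (HSP1 M3).
have NJ : var_le N5_var J by apply: var_le_joinl.
have JK : var_le J (HSP1 (K b)) by exact: (var_join_le NK (HSP1_le M3K)).
have JM3 : J M3 by apply: var_le_joinr; apply: in_HSP1.
have [EN|nEN] := pselect (N5_var = J); first by apply: M3_notin_N5; rewrite EN.
have [EK|nEK] := pselect (J = HSP1 (K b)); last by case: cov; exists J.
apply: (@K_notin b); have : J (K b) by rewrite EK; apply: in_HSP1.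
apply: var_join_le; first exact: N5M_N5.
by apply: HSP1_le; apply: N5M_M; apply: M3_modular.
Qed.

Definition generator (k : 'I_23) : lattice :=
  match split (k : 'I_(15 + 8)) with
  | inl i => match split (i : 'I_(5 + 10)) with
             | inl a => L1_to_5 a
             | inr b => K b
             end
  | inr j => V_lattice j
  end.

Variant generator_spec (k : 'I_23) : lattice -> Prop :=
| GenL (a : 'I_5) of k = a :> nat : generator_spec k (L1_to_5 a)
| GenK (b : 'I_10) of k = 5 + b :> nat : generator_spec k (K b)
| GenV (j : 'I_8) of k = 15 + j :> nat : generator_spec k (V_lattice j).

Lemma generatorP k : generator_spec k (generator k).
Proof.
rewrite /generator.
case: (splitP (k : 'I_(15 + 8))) => [i ki|j kj]; last exact: GenV.
by case: (splitP (i : 'I_(5 + 10))) => [a ia|b ib];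
  [apply: GenL | apply: GenK]; rewrite ki.
Qed.

Lemma generator_notin k : ~ N5M (generator k).
Proof.
case: generatorP => [a _|b _|j _];
  [rewrite L1_to_5E | exact: K_notin | rewrite V_latticeE].
  by apply: listed_notin; apply: (leq_trans (ltn_ord a)).
by apply: listed_notin; rewrite (ltn_add2l 5 _ 8).
Qed.
Lemma generator_prime k : join_prime (generator k).
Proof.
case: generatorP => [a _|b _|j _];
  [rewrite L1_to_5E | exact: K_prime | rewrite V_latticeE].
  by apply: listed_prime; apply: (leq_trans (ltn_ord a)).
by apply: listed_prime; rewrite (ltn_add2l 5 _ 8).
Qed.
Lemma generator_atomic k : atomic (generator k).
Proof.
case: generatorP => [a _|b _|j _];
  [rewrite L1_to_5E | exact: K_atomic | rewrite V_latticeE].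
  by apply: listed_atomic; apply: (leq_trans (ltn_ord a)).
by apply: listed_atomic; rewrite (ltn_add2l 5 _ 8).
Qed.

Lemma generator_inj k l : HSP1 (generator k) = HSP1 (generator l) -> k = l.
Proof.
have a13 (a : 'I_5) : (a < 13)%N by apply: (leq_trans (ltn_ord a)).
have j13 (j : 'I_8) : (5 + j < 13)%N by rewrite (ltn_add2l 5 _ 8).
have [_ Kinj char] := hK.
have KL b a : HSP1 (K b) <> HSP1 (L1_to_5 a).
  by have [|_ _] := (char (HSP1 (K b))).1; first by exists b.
case: (generatorP k) => [a ka|b kb|j kj];
  case: (generatorP l) => [a' la|b' lb|j' lj] E;
  apply: val_inj => /=.
- by rewrite ka la; apply: listed_inj => //; rewrite -!L1_to_5E.
- by case: (@KL b' a).
- have := listed_inj (a13 a) (j13 j').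
  rewrite -L1_to_5E -V_latticeE => /(_ E) aj.
  by have := ltn_ord a; rewrite aj ltnNge leq_addr.
- by case: (@KL b a').
- by rewrite kb lb (Kinj _ _ E).
- by case: (@K_neq_V b j').
- have := listed_inj (a13 a') (j13 j).
  rewrite -L1_to_5E -V_latticeE => /(_ (esym E)) aj.
  by have := ltn_ord a'; rewrite aj ltnNge leq_addr.
- by case: (@K_neq_V b' j).
- have := listed_inj (j13 j) (j13 j'); rewrite -!V_latticeE => /(_ E)/addnI jj.
  by rewrite kj lj jj.
Qed.

Definition genvar (k : 'I_23) : variety := with_M (HSP1 (generator k)).

Lemma genvar_covers k : var_covers N5M (genvar k).
Proof. exact: with_M_covers (@generator_notin k) (@generator_atomic k). Qed.
Lemma genvar_inj : injective genvar.
Proof.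
move=> k l /with_M_inj E; apply: generator_inj; apply: E;
  first [exact: generator_notin | exact: generator_prime].
Qed.

Lemma genvar_L (i : 'I_15) : genvar (lshift 8 i) = with_M (L_var K i).
Proof.
rewrite /genvar /generator /L_var (unsplitK (inl i : 'I_15 + 'I_8)).
by case: (split _).
Qed.
Lemma genvar_V (j : 'I_8) : genvar (rshift 15 j) = with_M (V_var j).
Proof. by rewrite /genvar /generator (unsplitK (inr j : 'I_15 + 'I_8)). Qed.

Lemma LmVmP Y : LmVm K Y <-> exists k, genvar k = Y.
Proof.
split=> [[[i ->]|[j ->]]|[k <-]].
- by exists (lshift 8 i); apply: genvar_L.
- by exists (rshift 15 j); apply: genvar_V.
rewrite -(splitK (k : 'I_(15 + 8))); case: (split _) => [i|j] /=.
  by left; exists i; apply: genvar_L.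
by right; exists j; apply: genvar_V.
Qed.
End Generators.

Theorem proposition3p1 (K : 'I_10 -> lattice) (hK : lists_L6_to_15 K) :
  [/\ (* (i) *)
      [/\ var_covers M_var (with_M N5_var),
          forall Y : variety, var_covers M_var Y -> Y = with_M N5_var
        & forall Y : variety, ~ var_le Y M_var -> var_le N5_var Y],
      (* (ii) *)
      forall i : 'I_15, var_covers (with_M N5_var) (with_M (L_var K i)),
      (* (iii) *)
      forall j : 'I_8, var_covers (with_M N5_var) (with_M (V_var j))
    & (* (iv) *)
      [/\ has_n_elements 23 (LmVm K),
          isomorphic_to_Boolean 23 (generated_sublattice (LmVm K))
        & is_interval (generated_sublattice (LmVm K))]].
Proof.
have MN : var_lt M_var N5M.
  split=> [|E]; first exact: N5M_M.
  have MN5 : M_var N5 by rewrite E; exact: (N5M_N5 (@in_HSP1 N5)).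
  exact: N5_nonmodular MN5.
have above_M Y : var_lt M_var Y -> var_le N5M Y.
  move=> [MY neMY]; apply: var_join_le => //; apply: nonmodular_N5 => YM.
  by apply: neMY; apply: var_le_anti.
split.
- split; last exact: nonmodular_N5.
    split=> // [[Z [MZ [ZN neZN]]]].
    by apply: neZN; apply: var_le_anti => //; apply: above_M.
  move=> Y [MY cov]; have NY := above_M Y MY.
  have [//|neYN] := pselect (Y = N5M); case: cov; exists N5M; split=> //.
  by split=> // E; apply: neYN.
- by move=> i; rewrite -(genvar_L K i); apply: genvar_covers hK _.
- by move=> j; rewrite -(genvar_V K j); apply: genvar_covers hK _.
- exact: (@boolean_interval _ 23 _ isT (genvar_covers hK) (genvar_inj hK) _
    (LmVmP K)).
Qed.
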